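(* Let $u_h\in V_h$ be the velocity solution of the EDG-HDG Stokes--Darcy discretization with source/sink term $f^d$ in $\Omega^d$, and consider the semi-discrete EDG transport scheme with this $u_h$, with polynomial degree $\ell$ and, for a constant $\tilde c$, with source term $f=-\chi^d f^d\tilde c$. Then the constant $\boldsymbol{c}_h=(\tilde c,\tilde c)$ is preserved by the semi-discrete transport scheme if and only if $$\sum_{K\in\mathcal{T}^d}(\Pi_Q f^d,w_h)_K=\sum_{K\in\mathcal{T}^d}(f^d,w_h)_K\qquad\forall w_h\in C_h .$$ This implies that if $f^d\ne 0$, one must choose $\ell=k-1$ for the EDG-HDG flow discretization together with the EDG transport scheme to be a compatible discretization of the coupled Stokes--Darcy flow and transport problem. If $f^d=0$, then $\ell$ can be chosen independent of $k$. (Thus the coupled discretization is compatible provided $\ell$ is suitably chosen in this sense; the global conservation part of compatibility is a known property of the EDG transport scheme.)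
   Context: **Compatibility.** A discretization of Stokes--Darcy flow coupled to transport is called compatible if it satisfies the following two properties at the discrete level. (i) Global conservation: $\int_\Omega\phi\,c(x,t)\,dx=\int_\Omega\phi\,c_0(x)\,dx+\int_0^t\int_\Omega f\,dx\,ds$. (ii) Preservation of constants: if the initial condition is $c_0(x)=\tilde c$ with $\tilde c$ a constant, and the source/sink term is $f=-\chi^d f^d\tilde c$, then $c(x,t)=\tilde c$ for $t>0$. That the constant $\boldsymbol{c}_h=(\tilde c,\tilde c)$ is preserved by the semi-discrete scheme means that, with $f=-\chi^df^d\tilde c$, $\boldsymbol{c}_h(t)=(\tilde c,\tilde c)$ satisfies the scheme, i.e. $B_h(u_h;(\tilde c,\tilde c),\boldsymbol{w}_h)=-\sum_{K\in\mathcal{T}^d}(f^d\tilde c,w_h)_K$ for all $\boldsymbol{w}_h\in\boldsymbol{C}_h$. **Domain, flow and transport problems.** $\dim\in\{2,3\}$; $\Omega\subset\mathbb{R}^{\dim}$ is a bounded polygonal domain with outward unit normal $n$, divided into two non-overlapping polygonal subdomains $\Omega^s,\Omega^d$ separated by the interface $\Gamma^I$. $\Gamma^j$ is the exterior boundary of $\Omega^j$ (the part of $\partial\Omega$ on the boundary of $\Omega^j$) and $n^j$ the outward unit normal of $\Omega^j$, $j=s,d$; on $\Gamma^I$, $n=n^s=-n^d$. $(w)^t:=w-(w\cdot n)n$ is the tangential component, $\varepsilon(u)=(\nabla u+\nabla u^T)/2$, $\chi^d$ is the characteristic function of $\Omega^d$, and $\mu,\kappa,\alpha>0$ are constants. The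 Stokes--Darcy problem for the velocity $u$ and pressure $p$, with $u^j,p^j$ the restrictions to $\Omega^j$, is: $-\nabla\cdot 2\mu\varepsilon(u)+\nabla p=f^s$ in $\Omega^s$; $\kappa^{-1}u+\nabla p=0$ in $\Omega^d$; $-\nabla\cdot u=\chi^d f^d$ in $\Omega$; $u=0$ on $\Gamma^s$; $u\cdot n=0$ on $\Gamma^d$; and on $\Gamma^I$: $u^s\cdot n=u^d\cdot n$, $p^s-2\mu\varepsilon(u^s)n\cdot n=p^d$, $-2\mu(\varepsilon(u^s)n)^t=\alpha\kappa^{-1/2}(u^s)^t$. It is coupled to the transport problem for the concentration $c$ over the time interval $(0,T]$: $\phi\,\partial_tc+\nabla\cdot(cu-D(u)\nabla c)=f$ in $\Omega\times(0,T]$, $D(u)\nabla c\cdot n=0$ on $\partial\Omega\times(0,T]$, $c(x,0)=c_0(x)$ in $\Omega$. Here $\phi$ is the porosity: $\phi=1$ in $\Omega^s$ and a constant in $(0,1]$ in $\Omega^d$. The diffusion/dispersion tensor $D$ satisfies, for constants $D_{\min}>0$, $C>0$ and all $u,v,x\in\mathbb{R}^{\dim}$: $D_{\min}|x|^2\le D(u)x\cdot x$, $|D(u)|\le C(1+|u|)$, $|D(u)-D(v)|\le C|u-v|$. **Mesh.** For $j=s,d$, $\mathcal{T}^j$ is a shape-regular triangulation of $\Omega^j$ into non-overlapping elements $K$, the two meshes matching at $\Gamma^I$; $\mathcal{T}=\mathcal{T}^s\cup\mathcal{T}^d$; $h_K$ is the diameter of $K$; $n$ (or $n^j$ for $K\in\mathcal{T}^j$)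 is also the outward unit normal on $\partial K$. $\mathcal{F}$, $\Gamma_0$ are the set and union of all facets, $\mathcal{F}^j,\Gamma_0^j$ the set and union of facets in $\overline{\Omega}^j$. $(\cdot,\cdot)_D$ and $\langle\cdot,\cdot\rangle_D$ are $L^2$ inner products on $\dim$- and $(\dim-1)$-dimensional sets. $P_m(D)$ is the space of polynomials of degree $m$ on $D$. **EDG-HDG flow discretization (degree $k$).** $V_h=\{v_h\in[L^2(\Omega)]^{\dim}: v_h|_K\in[P_k(K)]^{\dim}\ \forall K\in\mathcal{T}\}$, $Q_h=\{q_h\in L^2(\Omega): q_h|_K\in P_{k-1}(K)\ \forall K\in\mathcal{T}\}\cap L_0^2(\Omega)$ ($L_0^2$: zero mean), $\bar V_h=\{\bar v_h\in[L^2(\Gamma_0^s)]^{\dim}:\bar v_h|_F\in[P_k(F)]^{\dim}\ \forall F\in\mathcal{F}^s,\ \bar v_h=0\text{ on }\Gamma^s\}\cap[C^0(\Gamma_0^s)]^{\dim}$, $\bar Q_h^j=\{\bar q_h\in L^2(\Gamma_0^j):\bar q_h|_F\in P_k(F)\ \forall F\in\mathcal{F}^j\}$. $\boldsymbol{V}_h=V_h\times\bar V_h$, $\boldsymbol{Q}_h=Q_h\times\bar Q_h^s\times\bar Q_h^d$. Find $(\boldsymbol{u}_h,\boldsymbol{p}_h)\in\boldsymbol{V}_h\times\boldsymbol{Q}_h$ with $a_h(\boldsymbol{u}_h,\boldsymbol{v}_h)+b_h(\boldsymbol{p}_h,\boldsymbol{v}_h)+b_h(\boldsymbol{q}_h,\boldsymbol{u}_h)=(f^s,v_h)_{\Omega^s}+(f^d,q_h)_{\Omega^d}$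 for all $(\boldsymbol{v}_h,\boldsymbol{q}_h)\in\boldsymbol{V}_h\times\boldsymbol{Q}_h$, where $$a_h(\boldsymbol{u},\boldsymbol{v})=\sum_{K\in\mathcal{T}^s}\Big[(2\mu\varepsilon(u),\varepsilon(v))_K+\langle\tfrac{2\beta_f\mu}{h_K}(u-\bar u),v-\bar v\rangle_{\partial K}-\langle2\mu\varepsilon(u)n^s,v-\bar v\rangle_{\partial K}-\langle2\mu\varepsilon(v)n^s,u-\bar u\rangle_{\partial K}\Big]+(\kappa^{-1}u,v)_{\Omega^d}+\langle\alpha\kappa^{-1/2}\bar u^t,\bar v^t\rangle_{\Gamma^I},$$ $$b_h(\boldsymbol{p},\boldsymbol{v})=-\sum_{K\in\mathcal{T}}(p,\nabla\cdot v)_K+\sum_{j=s,d}\sum_{K\in\mathcal{T}^j}\langle\bar p^j,v\cdot n^j\rangle_{\partial K}-\langle\bar p^s-\bar p^d,\bar v\cdot n\rangle_{\Gamma^I}.$$ For a sufficiently large penalty parameter $\beta_f>0$ there is a unique solution; $u_h$, the first component of $\boldsymbol{u}_h=(u_h,\bar u_h)$, is called the velocity solution. $\Pi_Q$ is the standard $L^2$-projection into $Q_h$; the velocity solution satisfies $-\nabla\cdot u_h=\chi^d\Pi_Qf^d$ on each element and has single-valued normal component on facets. **EDG transport scheme (degree $\ell$).** $C_h=\{c_h\in L^2(\Omega):c_h|_K\in P_\ell(K)\ \forall K\in\mathcal{T}\}$, $\bar C_h=\{\bar c_h\in L^2(\Gamma_0):\bar c_h|_F\in P_\ell(F)\ \forall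 F\in\mathcal{F}\}\cap C^0(\Gamma_0)$, $\boldsymbol{C}_h=C_h\times\bar C_h$. For each $t>0$ find $\boldsymbol{c}_h(t)=(c_h(t),\bar c_h(t))\in\boldsymbol{C}_h$ with $$\sum_{K\in\mathcal{T}}(\phi\,\partial_tc_h(t),w_h)_K+B_h(u_h;\boldsymbol{c}_h(t),\boldsymbol{w}_h)=\sum_{K\in\mathcal{T}}(f(t),w_h)_K\quad\forall\boldsymbol{w}_h=(w_h,\bar w_h)\in\boldsymbol{C}_h,$$ with $c_h(0)$ the $L^2$-projection of $c_0$ into $C_h$. Here $B_h=B_h^a+B_h^d$, $$B_h^a(u;\boldsymbol{c},\boldsymbol{w})=\sum_{K\in\mathcal{T}}\Big[-(c\,u,\nabla w)_K+\langle c\,u\cdot n,w-\bar w\rangle_{\partial K}-\langle u\cdot n\,(c-\bar c),w-\bar w\rangle_{\partial K^{\rm in}}\Big],$$ $$B_h^d(u;\boldsymbol{c},\boldsymbol{w})=\sum_{K\in\mathcal{T}}\Big[(D(u)\nabla c,\nabla w)_K-\langle[D(u)\nabla c]\cdot n,w-\bar w\rangle_{\partial K}+\tfrac{\beta_c}{h_K}\langle[D(u)n](c-\bar c),(w-\bar w)n\rangle_{\partial K}-\langle[D(u)\nabla w]\cdot n,c-\bar c\rangle_{\partial K}\Big],$$ $\partial K^{\rm in}$ is the portion of $\partial K$ where $u_h\cdot n<0$, and $\beta_c>0$ is a penalty parameter.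
   Formalization: ''Must choose ℓ=k−1'' fails literally (ℓ<k−1 works; so does any ℓ for piecewise P_{k−1} sources); proved instead: compatible for all nonzero zero-mean f^d iff ℓ≤k−1, and given ℓ≥k−1 iff ℓ=k−1. The equivalence is for c̃≠0, or for all constants together. *)

(* Defs.v *)
From HB Require Import structures.
From mathcomp Require Import all_boot all_order all_algebra.
From mathcomp Require Import all_classical all_reals all_analysis.

Set Implicit Arguments.
Unset Strict Implicit.
Unset Printing Implicit Defensive.

Import Order.TTheory GRing.Theory Num.Theory.
Import numFieldNormedType.Exports.

Local Open Scope classical_set_scope.
Local Open Scope ring_scope.

(* The library has product measures but no Lebesgue measure on R^n; it is
   built here on [n.-tuple R] by recursion on [n]. *)
Section LebesgueTuple.
Context {R : realType}.
Notation mR := (measurableTypeR R).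

Definition tcons n (x : mR * n.-tuple mR) : n.+1.-tuple mR :=
  [tuple of x.1 :: x.2].
Definition tuncons n (t : n.+1.-tuple mR) : mR * n.-tuple mR :=
  (thead t, [tuple of behead t]).

Lemma tconsK n : cancel (@tcons n) (@tuncons n).
Proof.
by case=> x t; rewrite /tuncons /tcons /=; congr pair; apply/val_inj.
Qed.

Lemma measurable_tcons n : measurable_fun setT (@tcons n).
Proof. by apply: measurable_cons. Qed.

Lemma measurable_tuncons n : measurable_fun setT (@tuncons n).
Proof.
apply: (@measurable_fun_pair _ _ _ _ _ _ (fun t => thead t)
  (fun t => [tuple of behead t])).
  exact: measurable_tnth.
exact: measurable_behead.
Qed.

Section Step.
Context n (mu : {sigma_finite_measure set (n.-tuple mR) -> \bar R}).

Definition lebesgue_step : set (n.+1.-tuple mR) -> \bar R :=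
  pushforward (lebesgue_measure \x mu)%E (@tcons n).

Let step0 : lebesgue_step set0 = 0%E.
Proof. by rewrite /lebesgue_step /pushforward preimage_set0 measure0. Qed.

Let step_ge0 A : (0 <= lebesgue_step A)%E.
Proof. exact: (measure_ge0 (lebesgue_measure \x mu)%E). Qed.

Let step_sigma_additive : semi_sigma_additive lebesgue_step.
Proof.
exact: (@measure_semi_sigma_additive _ _ _
  (measure_function_pushforward__canonical__measure_function_Measure
     (lebesgue_measure \x mu)%E (@measurable_tcons n))).
Qed.

HB.instance Definition _ := isMeasure.Build _ _ _ lebesgue_step
  step0 step_ge0 step_sigma_additive.

Let prod_sigma_finite : sigma_finite setT (lebesgue_measure \x mu)%E.
Proof.
have /sigma_finiteP[F [FT ndF Foo]] := sigma_finiteT (@lebesgue_measure R).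
have /sigma_finiteP[G [GT ndG Goo]] := sigma_finiteT mu.
exists (fun i => F i `*` G i).
  rewrite -setXTT FT GT predeqE => -[x y]; split.
    move=> [/= [i _ Fix] [j _ Gjy]]; exists (maxn i j) => //; split.
    - by move: x Fix; exact/subsetPset/ndF/leq_maxl.
    - by move: y Gjy; exact/subsetPset/ndG/leq_maxr.
  by move=> [i _ []/= ? ?]; split; exists i.
move=> i; have [mF Fi] := Foo i; have [mG Gi] := Goo i.
split; first exact: measurableX.
rewrite product_measure1E//.
by rewrite lte_mul_pinfty// ge0_fin_numE.
Qed.

Let step_sigma_finite : sigma_finite setT lebesgue_step.
Proof.
have [F FT Foo] := prod_sigma_finite.
exists (fun i => @tuncons n @^-1` F i).
  by rewrite -preimage_bigcup -FT preimage_setT.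
move=> i; have [mF Fi] := Foo i; split.
  by rewrite -[X in measurable X]setTI; exact: measurable_tuncons.
rewrite /lebesgue_step /pushforward -comp_preimage.
by rewrite (_ : _ \o _ = id) ?preimage_id//; apply/funext => x /=; rewrite tconsK.
Qed.

HB.instance Definition _ := Measure_isSigmaFinite.Build _ _ _ lebesgue_step
  step_sigma_finite.

End Step.

Fixpoint lebesgue_tuple n : {sigma_finite_measure set (n.-tuple mR) -> \bar R} :=
  if n is m.+1 then lebesgue_step (lebesgue_tuple m) else \d_ [tuple].
End LebesgueTuple.

Section VectorCalculus.
Context {R : realType} {dim : nat}.
Implicit Types (u v x : 'rV[R]_dim).

Definition dot u v : R := \sum_i u 0 i * v 0 i.

(* Euclidean norm of vectors, Frobenius norm of matrices; the norm [`|_|] that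
   the library puts on matrices is the max norm. *)
Definition enorm m n (A : 'M[R]_(m, n)) : R :=
  Num.sqrt (\sum_i \sum_j A i j ^+ 2).

Definition frob (A B : 'M[R]_dim) : R := \sum_i \sum_j A i j * B i j.

(* Matrix-vector product [A v]; vectors are stored as rows. *)
Definition mulv (A : 'M[R]_dim) v : 'rV[R]_dim := v *m A^T.

Definition tangential v n : 'rV[R]_dim := v - dot v n *: n.

Definition grad (g : 'rV[R]_dim -> R) x : 'rV[R]_dim :=
  \row_j 'D_(delta_mx 0 j) g x.
Definition jac (w : 'rV[R]_dim -> 'rV[R]_dim) x : 'M[R]_dim :=
  \matrix_(i, j) 'D_(delta_mx 0 j) (fun y => w y 0 i) x.
Definition strain w x : 'M[R]_dim := 2^-1 *: (jac w x + (jac w x)^T).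
Definition diverg w x : R := \tr (jac w x).

Definition bdry (A : set 'rV[R]_dim) : set 'rV[R]_dim := closure A `\` A°.

Definition diameter (A : set 'rV[R]_dim) : R :=
  sup [set r | exists x y, [/\ A x, A y & r = enorm (x - y)]].

(* Polynomials in [dim] variables of total degree at most [m]: the coefficient
   of the monomial of exponent [e] is [a e]. *)
Definition exponent (m : nat) := {ffun 'I_dim -> 'I_m.+1}.
Definition polyval m (a : exponent m -> R) x : R :=
  \sum_(e : exponent m | (\sum_i e i <= m)%N) a e * \prod_i x 0 i ^+ e i.
Definition is_poly m (g : 'rV[R]_dim -> R) : Prop :=
  exists a : exponent m -> R, forall x, g x = polyval a x.

End VectorCalculus.

(* Simplices are given by finite sets [S] of vertices of positions [pos]. *)
Section Simplex.
Context {R : realType} {dim : nat} {V : finType} (pos : V -> 'rV[R]_dim).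
Implicit Types (S : {set V}) (g : 'rV[R]_dim -> R).

Definition hull S : set 'rV[R]_dim :=
  [set x | exists a : V -> R,
     [/\ forall v, v \in S -> 0 <= a v,
         \sum_(v in S) a v = 1
       & x = \sum_(v in S) a v *: pos v]].

Definition affinely_independent S : Prop :=
  forall a : V -> R,
    \sum_(v in S) a v = 0 -> \sum_(v in S) a v *: pos v = 0 ->
    forall v, v \in S -> a v = 0.

Definition svertex S (i : nat) : 'rV[R]_dim := nth 0 [seq pos v | v <- enum S] i.

Definition edges m S : 'M[R]_(m, dim) :=
  \matrix_(i < m) (svertex S i.+1 - svertex S 0).

Definition ref_simplex m : set (m.-tuple (measurableTypeR R)) :=
  [set t | (forall i, 0 <= tnth t i) /\ \sum_i tnth t i <= 1].

Definition param m S (t : m.-tuple (measurableTypeR R)) : 'rV[R]_dim :=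
  svertex S 0 + \sum_(i < m) tnth t i *: (svertex S i.+1 - svertex S 0).

(* For [S] of [m.+1] affinely independent vertices, the integral of [g] over the
   simplex [hull S] with respect to [m]-dimensional (volume or surface) measure,
   computed in the affine parametrization by the reference simplex. The factor
   is the root of the Gram determinant of the edges; it equals the absolute
   value of [\det (edges m S)] when [m = dim]. *)
Definition simplex_int m S g : R :=
  Num.sqrt (\det (edges m S *m (edges m S)^T)) *
  \int[lebesgue_tuple m]_(t in @ref_simplex m) g (param S t).

(* [g] is in L^2 of the simplex [hull S]. *)
Definition simplex_L2 m S g : Prop :=
  measurable_fun (@ref_simplex m) (fun t => g (param S t)) /\
  (lebesgue_tuple m).-integrable (@ref_simplex m)
    (fun t => (g (param S t) ^+ 2)%:E).

End Simplex.

(* A conforming simplicial mesh of a domain divided into two parts. A simplex is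
   the set of its vertices. Conformity covers the matching of the two
   submeshes at the interface. The domain is the interior of the union of the
   closed elements. *)
Record mesh (R : realType) (dim : nat) := Mesh {
  mvertex : finType;
  mpos : mvertex -> 'rV[R]_dim;
  mesh_s : {set {set mvertex}};
  mesh_d : {set {set mvertex}};
  mesh_card : forall K, K \in (mesh_s :|: mesh_d)%SET -> #|K| = dim.+1;
  mesh_nondegenerate : forall K, K \in (mesh_s :|: mesh_d)%SET ->
    affinely_independent mpos K;
  mesh_conforming : forall K L,
    K \in (mesh_s :|: mesh_d)%SET -> L \in (mesh_s :|: mesh_d)%SET ->
    hull mpos K `&` hull mpos L = hull mpos (K :&: L)%SET;
  mesh_disjoint : forall K, K \in mesh_s -> K \notin mesh_d;
  mesh_s_nonempty : (0 < #|mesh_s|)%N;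
  mesh_d_nonempty : (0 < #|mesh_d|)%N;
  mesh_connected : connected
    ([set x | exists2 K, K \in (mesh_s :|: mesh_d)%SET & hull mpos K x]°)
}.

(* [par_phi] is the porosity in the Darcy region; [par_betaf] and [par_betac] are
   the penalty parameters of the flow and transport discretizations. *)
Record params (R : realType) (dim : nat) := Params {
  par_mu : R; par_kappa : R; par_alpha : R; par_phi : R;
  par_betaf : R; par_betac : R; par_T : R;
  par_D : 'rV[R]_dim -> 'M[R]_dim;
  par_mu_gt0 : 0 < par_mu;
  par_kappa_gt0 : 0 < par_kappa;
  par_alpha_gt0 : 0 < par_alpha;
  par_phi_gt0 : 0 < par_phi;
  par_phi_le1 : par_phi <= 1;
  par_betaf_gt0 : 0 < par_betaf;
  par_betac_gt0 : 0 < par_betac;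
  par_T_gt0 : 0 < par_T;
  par_D_dispersion : exists Dmin C : R,
    [/\ 0 < Dmin, 0 < C,
        forall u x, Dmin * enorm x ^+ 2 <= dot (mulv (par_D u) x) x,
        forall u, enorm (par_D u) <= C * (1 + enorm u)
      & forall u v, enorm (par_D u - par_D v) <= C * enorm (u - v)]
}.

Section Discretization.
Context {R : realType} {dim : nat} (M : mesh R dim) (P : params R dim).
Notation V := (mvertex M).
Notation point := 'rV[R]_dim.
Notation pos := (@mpos R dim M).
Notation Ts := (mesh_s M).
Notation Td := (mesh_d M).

Definition cells : {set {set V}} := (Ts :|: Td)%SET.

(* Functions in broken spaces are families indexed by the elements: [c K] is the
   function on [K], with polynomials on [K] identified with polynomials on the
   whole space. Facet functions that may be discontinuous at facet boundaries are
   families indexed by the facets. Values at other indices are irrelevant. *)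
Definition broken := {set V} -> point -> R.
Definition vbroken := {set V} -> point -> point.

Definition facet_of (K F : {set V}) : bool := (F \subset K) && (#|F| == dim).
Definition is_facet (T : {set {set V}}) (F : {set V}) : bool :=
  [exists K in T, facet_of K F].

Definition region (T : {set {set V}}) : set point :=
  [set x | exists2 K, K \in T & hull pos K x]°.
Definition skeleton (T : {set {set V}}) : set point :=
  [set x | exists2 F, is_facet T F & hull pos F x].
Definition Gamma_s : set point := bdry (region cells) `&` bdry (region Ts).

Definition outward_normal (K F : {set V}) : point :=
  xget 0 [set n | [/\ dot n n = 1,
    forall a b, a \in F -> b \in F -> dot n (pos a - pos b) = 0
    & forall v a, v \in K -> v \notin F -> a \in F ->
        dot n (pos v - pos a) < 0]].

Definition cell_int (K : {set V}) (g : point -> R) : R := simplex_int pos dim K g.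
Definition facet_int (F : {set V}) (g : point -> R) : R :=
  simplex_int pos dim.-1 F g.

(* Integrals over the boundary of [K] and over the interface; the integrand is
   given the facet, the unit normal and the point. The facets on the interface
   are those shared by an element of each submesh, and the normal there is
   outward from the Stokes side. *)
Definition bdry_int (K : {set V}) (g : {set V} -> point -> point -> R) : R :=
  \sum_(F : {set V} | facet_of K F) facet_int F (g F (outward_normal K F)).
Definition interface_int (g : {set V} -> point -> point -> R) : R :=
  \sum_(K in Ts) \sum_(F : {set V} | facet_of K F && is_facet Td F)
    facet_int F (g F (outward_normal K F)).

Definition hdiam (K : {set V}) : R := diameter (hull pos K).

Definition L2_on (T : {set {set V}}) (g : point -> R) : Prop :=
  forall K, K \in T -> simplex_L2 pos dim K g.

Definition in_broken (m : nat) (c : broken) : Prop :=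
  forall K, K \in cells -> is_poly m (c K).

Definition facet_poly (m : nat) (F : {set V}) (g : point -> R) : Prop :=
  exists2 q, is_poly m q & forall x, hull pos F x -> g x = q x.

Definition in_Vh (k : nat) (v : vbroken) : Prop :=
  forall K, K \in cells -> forall i, is_poly k (fun x => v K x 0 i).

Definition in_Vbar (k : nat) (vb : point -> point) : Prop :=
  [/\ forall F, is_facet Ts F -> forall i, facet_poly k F (fun x => vb x 0 i),
      {within skeleton Ts, continuous vb}
    & forall x, Gamma_s x -> vb x = 0].

Definition in_Qh (k : nat) (q : broken) : Prop :=
  in_broken k.-1 q /\ \sum_(K in cells) cell_int K (q K) = 0.

Definition in_Qbar (k : nat) (T : {set {set V}}) (qb : broken) : Prop :=
  forall F, is_facet T F -> facet_poly k F (qb F).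

Definition in_Ch (l : nat) (c : broken) : Prop := in_broken l c.

Definition in_Cbar (l : nat) (cb : point -> R) : Prop :=
  (forall F, is_facet cells F -> facet_poly l F cb) /\
  {within skeleton cells, continuous cb}.

Definition ah (u : vbroken) (ub : point -> point)
    (v : vbroken) (vb : point -> point) : R :=
  \sum_(K in Ts)
    (cell_int K (fun x =>
       2 * par_mu P * frob (strain (u K) x) (strain (v K) x))
     + bdry_int K (fun _ n x =>
         2 * par_betaf P * par_mu P / hdiam K *
         dot (u K x - ub x) (v K x - vb x))
     - bdry_int K (fun _ n x =>
         dot (2 * par_mu P *: mulv (strain (u K) x) n) (v K x - vb x))
     - bdry_int K (fun _ n x =>
         dot (2 * par_mu P *: mulv (strain (v K) x) n) (u K x - ub x)))
  + \sum_(K in Td) cell_int K (fun x => (par_kappa P)^-1 * dot (u K x) (v K x))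
  + interface_int (fun _ n x =>
      par_alpha P * (Num.sqrt (par_kappa P))^-1 *
      dot (tangential (ub x) n) (tangential (vb x) n)).

Definition bh (p ps pd : broken) (v : vbroken) (vb : point -> point) : R :=
  - \sum_(K in cells) cell_int K (fun x => p K x * diverg (v K) x)
  + (\sum_(K in Ts) bdry_int K (fun F n x => ps F x * dot (v K x) n)
     + \sum_(K in Td) bdry_int K (fun F n x => pd F x * dot (v K x) n))
  - interface_int (fun F n x => (ps F x - pd F x) * dot (vb x) n).

Definition flow_solution (k : nat) (fs : point -> point) (fd : point -> R)
    (u : vbroken) (ub : point -> point) (p ps pd : broken) : Prop :=
  [/\ in_Vh k u, in_Vbar k ub, in_Qh k p, in_Qbar k Ts ps & in_Qbar k Td pd] /\
  forall v vb q qs qd,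
    in_Vh k v -> in_Vbar k vb -> in_Qh k q -> in_Qbar k Ts qs ->
    in_Qbar k Td qd ->
    ah u ub v vb + bh p ps pd v vb + bh q qs qd u ub =
      \sum_(K in Ts) cell_int K (fun x => dot (fs x) (v K x)) +
      \sum_(K in Td) cell_int K (fun x => fd x * q K x).

Definition velocity_solution k fs fd (u : vbroken) : Prop :=
  exists ub p ps pd, flow_solution k fs fd u ub p ps pd.

(* [pf] is the L^2-projection into [Q_h] of the source, which is [fd] on the
   Darcy region and 0 elsewhere. *)
Definition is_PiQ (k : nat) (fd : point -> R) (pf : broken) : Prop :=
  in_Qh k pf /\
  forall q, in_Qh k q ->
    \sum_(K in cells) cell_int K (fun x => pf K x * q K x) =
    \sum_(K in Td) cell_int K (fun x => fd x * q K x).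

Definition porosity (K : {set V}) : R := if K \in Ts then 1 else par_phi P.

Definition Ba (u : vbroken) (c : broken) (cb : point -> R)
    (w : broken) (wb : point -> R) : R :=
  \sum_(K in cells)
    (- cell_int K (fun x => c K x * dot (u K x) (grad (w K) x))
     + bdry_int K (fun _ n x => c K x * dot (u K x) n * (w K x - wb x))
     - bdry_int K (fun _ n x =>
         if dot (u K x) n < 0
         then dot (u K x) n * (c K x - cb x) * (w K x - wb x) else 0)).

Definition Bd (u : vbroken) (c : broken) (cb : point -> R)
    (w : broken) (wb : point -> R) : R :=
  \sum_(K in cells)
    (cell_int K (fun x =>
       dot (mulv (par_D P (u K x)) (grad (c K) x)) (grad (w K) x))
     - bdry_int K (fun _ n x =>
         dot (mulv (par_D P (u K x)) (grad (c K) x)) n * (w K x - wb x))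
     + par_betac P / hdiam K * bdry_int K (fun _ n x =>
         dot ((c K x - cb x) *: mulv (par_D P (u K x)) n)
             ((w K x - wb x) *: n))
     - bdry_int K (fun _ n x =>
         dot (mulv (par_D P (u K x)) (grad (w K) x)) n * (c K x - cb x))).

Definition Bh u c cb w wb : R := Ba u c cb w wb + Bd u c cb w wb.

Definition cst_cell (a : R) : broken := fun _ _ => a.
Definition cst_facet (a : R) : point -> R := fun _ => a.

(* The constant [(a, a)], which does not depend on time, satisfies the
   semi-discrete scheme with source [- a * fd] on the Darcy region. *)
Definition preserves_constant (l : nat) (u : vbroken) (fd : point -> R) (a : R) :
    Prop :=
  forall w wb, in_Ch l w -> in_Cbar l wb ->
    Bh u (cst_cell a) (cst_facet a) w wb =
    - \sum_(K in Td) cell_int K (fun x => fd x * a * w K x).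

(* [pf] and [fd] have the same moments against [C_h] on the Darcy region; used
   with [pf] the projection of [fd]. *)
Definition projection_exact (l : nat) (fd : point -> R) (pf : broken) : Prop :=
  forall w, in_Ch l w ->
    \sum_(K in Td) cell_int K (fun x => pf K x * w K x) =
    \sum_(K in Td) cell_int K (fun x => fd x * w K x).

(* Curves in the finite-dimensional space [C_h] that are continuous on [0, T] and
   differentiable on ]0, T[; differentiability is that of the coefficients. *)
Definition Ch_curve (l : nat) (c : R -> broken) : Prop :=
  exists a : R -> {set V} -> exponent l -> R,
    [/\ forall t K x, 0 <= t <= par_T P -> K \in cells ->
          c t K x = polyval (a t K) x,
        forall K e, {within `[0, par_T P], continuous (fun t => a t K e)}
      & forall K e t, 0 < t < par_T P -> derivable (fun s => a s K e) t 1].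

(* Sources for which the scheme is an ordinary differential equation with
   continuous right-hand side. *)
Definition time_source (l : nat) (f : R -> point -> R) : Prop :=
  (forall t, 0 <= t <= par_T P -> L2_on cells (f t)) /\
  forall w, in_Ch l w ->
    {within `[0, par_T P], continuous
      (fun t => \sum_(K in cells) cell_int K (fun x => f t x * w K x))}.

Definition transport_solution (l : nat) (u : vbroken) (f : R -> point -> R)
    (c0 : point -> R) (c : R -> broken) (cb : R -> point -> R) : Prop :=
  [/\ Ch_curve l c,
      forall t, 0 < t < par_T P -> in_Cbar l (cb t),
      forall w, in_Ch l w ->
        \sum_(K in cells) cell_int K (fun x => c 0 K x * w K x) =
        \sum_(K in cells) cell_int K (fun x => c0 x * w K x)
    & forall t, 0 < t < par_T P -> forall w wb, in_Ch l w -> in_Cbar l wb ->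
        \sum_(K in cells) cell_int K (fun x =>
           porosity K * 'D_1 (fun s => c s K x) t * w K x)
        + Bh u (c t) (cb t) w wb =
        \sum_(K in cells) cell_int K (fun x => f t x * w K x)].

Definition globally_conservative (l : nat) (u : vbroken) : Prop :=
  forall f c0 c cb,
    time_source l f -> L2_on cells c0 -> transport_solution l u f c0 c cb ->
    forall t, 0 <= t <= par_T P ->
      \sum_(K in cells) cell_int K (fun x => porosity K * c t K x) =
      \sum_(K in cells) cell_int K (fun x => porosity K * c0 x) +
      \int[lebesgue_measure]_(s in `[0, t])
        (\sum_(K in cells) cell_int K (f s)).

(* A source of the flow problem. The zero mean is forced by the continuous
   problem: the divergence of [u] is [- fd] on the Darcy region and 0 elsewhere,
   while [u] has no normal component on the boundary of the domain. *)
Definition flow_data (fs : point -> point) (fd : point -> R) : Prop :=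
  [/\ forall i, L2_on Ts (fun x => fs x 0 i), L2_on Td fd
    & \sum_(K in Td) cell_int K fd = 0].

Definition nonzero_source (fd : point -> R) : Prop :=
  \sum_(K in Td) cell_int K (fun x => fd x ^+ 2) != 0.

(* Both parts of compatibility, for every velocity solution with data [fs] and
   [fd]. *)
Definition compatible (k l : nat) (fs : point -> point) (fd : point -> R) :
    Prop :=
  forall u, velocity_solution k fs fd u ->
    globally_conservative l u /\ forall a, preserves_constant l u fd a.

End Discretization.

(* Main.v *)
Require Import Defs.
From mathcomp Require Import all_boot all_order all_algebra.
From mathcomp Require Import all_classical all_reals all_analysis.
From mathcomp Require Import measurable_realfun perm ring lra.
Set Implicit Arguments.
Unset Strict Implicit.
Unset Printing Implicit Defensive.
Import Order.TTheory GRing.Theory Num.Theory.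
Import numFieldNormedType.Exports.
Local Open Scope classical_set_scope.
Local Open Scope ring_scope.

(* With [c_h = (a, a)] the diffusive and upwind terms vanish. Integration by parts
   on each element, and the vanishing of the jumps of [u . n] across facets, turn
   the transport form into [a * sum_K (w, div u)_K]. The flow scheme tested with
   pressures gives [div u = - Pi_Q f], so that preservation of constants says that
   [f - Pi_Q f] is orthogonal to [C_h]; this holds when [l <= k - 1], and trivially
   when [f = 0]. For [l >= k] it fails for a source supported on one Darcy element
   and orthogonal to the polynomials of degree [k - 1], for which the discrete
   velocity 0 is a solution. Global conservation follows by testing with 1.

   All integrands are polynomials, so the divergence theorem reduces to the
   Dirichlet formula
   [int_S prod_v lam_v^a_v = m! |S| prod_v a_v! / (m + sum_v a_v)!]
   for monomials in the barycentric coordinates of an [m]-simplex [S]. *)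

(** * Dirichlet integrals *)

(** Two obstacles shape the argument. First, pressures in [Q_h] have zero mean, so the flow scheme
    cannot be tested with constants. What is missing is recovered from the divergence theorem summed
    over the mesh and from the zero mean of the source, or, in the equivalence with exactness of the
    projection, from exactness itself. Second, the facet functions of the transport scheme may have
    degree larger than [k], so that orthogonality of the normal jump to multipliers of degree [k] is
    not enough. The jump is shown to vanish in the L^2 sense, and [simplex_int_sqr_eq0] then removes
    it against every bounded facet function; the same lemma turns all other L^2 identities into
    identities against test functions. In the counterexample the source has to be one pointwise
    function on the whole domain, although it lives on a single element. Of the [k + 1] bubble
    factors, [k] are consumed by the derivatives, and the last one makes the source vanish on the
    boundary of the element, so that its extension by 0 agrees on neighbouring elements. *)

Section Dirichlet.
Context {R : realType}.
Local Notation mR := (measurableTypeR R).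

Lemma integral_horner_deriv (p : {poly R}) (r : R) : 0 <= r ->
  (\int[lebesgue_measure]_(x in `[0%R, r]) (p^`()%R.[x])%:E)%E
    = (p.[r] - p.[0])%:E.
Proof.
rewrite le_eqVlt => /predU1P[<-|r0].
  by rewrite set_itv1 integral_set1 subrr.
rewrite (@continuous_FTC2 _ (horner p^`()%R) (horner p)) ?EFinB//.
- by apply: continuous_subspaceT => x; exact: continuous_horner.
- split.
  + by move=> x _; exact: derivable_horner.
  + by apply: cvg_at_right_filter; exact: continuous_horner.
  + by apply: cvg_at_left_filter; exact: continuous_horner.
- by move=> x _; rewrite -derivE.
Qed.

(* Induction on [b]: integrating the derivative of [x^b (r-x)^n.+1]
   trades a factor [x] for a factor [r - x]. *)
Lemma integral_beta (b n : nat) (r : R) : 0 <= r ->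
  (\int[lebesgue_measure]_(x in `[0%R, r]) (x ^+ b * (r - x) ^+ n)%:E)%E
    = ((b`! * n`!)%:R / ((b + n).+1)`!%:R * r ^+ (b + n).+1)%:E.
Proof.
move=> r0.
(* A polynomial antiderivative normalised by [p.[0] = 0] turns the induction into algebra; the
   integral is taken only once, at the end. *)
have [p [dp p0 pr]] : exists p : {poly R},
  [/\ p^`() = 'X^b * (r%:P - 'X) ^+ n, p.[0] = 0 &
      p.[r] = (b`! * n`!)%:R / ((b + n).+1)`!%:R * r ^+ (b + n).+1].
  elim: b n => [|b IH] n.
    exists ((n.+1)%:R^-1 *: ((r ^+ n.+1)%:P - (r%:P - 'X) ^+ n.+1)); split.
    - rewrite derivZ derivB derivC sub0r deriv_exp/=.
      rewrite derivB derivC derivX sub0r expr0 mul1r mulN1r mulNrn opprK.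
      by rewrite -[X in _ *: X]scaler_nat scalerA mulVf ?scale1r// pnatr_eq0.
    - by rewrite !hornerE subr0 subrr mulr0.
    - rewrite !hornerE subrr expr0n/= subr0 ?add0n ?fact0 ?mul1n factS natrM.
      by rewrite invfM mulrCA mulfV ?pnatr_eq0 ?mulr1 // -lt0n fact_gt0.
  have [p [dp p0 pr]] := IH n.+1.
  exists ((n.+1)%:R^-1 *: (b.+1%:R *: p - 'X^(b.+1) * (r%:P - 'X) ^+ n.+1)); split.
  - rewrite derivZ derivB derivZ dp derivM derivXn deriv_exp/=.
    rewrite derivB derivC derivX sub0r.
    rewrite -!mul_polyC polyC_natr.
    have c1 : (n.+1%:R^-1)%:P * n.+1%:R = 1 :> {poly R}.
      by rewrite -polyC_natr -polyCM mulVf// pnatr_eq0.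
    rewrite -(mulr_natr 'X^b) -(mulr_natr (-1 * _)) -[RHS]mul1r -[in RHS]c1.
    rewrite !(exprS _ n) !(exprS _ b).
    by ring.
  - by rewrite !hornerE p0 ?exprS ?mulr0 ?mul0r ?subr0 ?mulr0.
  - have z : 0 ^+ n.+1 = 0 :> R by rewrite exprS mul0r.
    rewrite hornerZ hornerD hornerN hornerZ hornerM !horner_exp hornerD hornerN.
    rewrite hornerC !hornerX subrr z mulr0 subr0 pr addSnnS.
    move: (r ^+ _) (fact_gt0 (b + n.+1).+1) => q.
    move: (_.+1)`! => N N0; rewrite (factS b) (factS n) !natrM; field.
    by rewrite nat1r !pnatr_eq0 /= -!lt0n N0.
transitivity (\int[lebesgue_measure]_(x in `[0%R, r]) (p^`()%R.[x])%:E)%E.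
  by apply: eq_integral => x _; rewrite dp !hornerE.
by rewrite integral_horner_deriv// p0 pr subr0.
Qed.

Definition dilated_simplex m (r : R) : set (m.-tuple mR) :=
  [set t | (forall i, 0 <= tnth t i) /\ \sum_i tnth t i <= r].

Lemma measurable_sum_tnth m :
  measurable_fun setT (fun t : m.-tuple mR => \sum_i tnth t i).
Proof. by apply: measurable_sum => i; exact: measurable_tnth. Qed.

Lemma measurable_dilated_simplex m r : measurable (@dilated_simplex m r).
Proof.
rewrite [dilated_simplex _](_ : _ =
  (\bigcap_(i in [set: 'I_m]) ((fun t : m.-tuple mR => tnth t i) @^-1` `[0, +oo[))
  `&` ((fun t : m.-tuple mR => \sum_i tnth t i) @^-1` `]-oo, r])).
  apply: measurableI.
    apply: fin_bigcap_measurable => // i _.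
    rewrite -[X in measurable X]setTI.
    by apply: measurable_tnth => //; exact: measurable_itv.
  rewrite -[X in measurable X]setTI.
  by apply: measurable_sum_tnth => //; exact: measurable_itv.
apply/seteqP; split => [t [t0 tr]|t [t0 tr]]; split.
- by move=> i _ /=; rewrite in_itv/= t0.
- by rewrite /= in_itv/=.
- by move=> i; have := t0 i I; rewrite /= in_itv/= andbT.
- by move: tr; rewrite /= in_itv/=.
Qed.

(** The factor [r - \sum_i tnth t i] is the coordinate of the vertex at the origin: for [r = 1] this
    is a monomial in all [m.+1] barycentric coordinates of the reference simplex. *)
Definition dirichlet_monomial m (a : nat) (g : nat -> nat) (r : R)
    (t : m.-tuple mR) : R :=
  (r - \sum_i tnth t i) ^+ a * \prod_(i < m) tnth t i ^+ g i.

Lemma measurable_dirichlet_monomial m a g r :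
  measurable_fun setT (@dirichlet_monomial m a g r).
Proof.
apply: measurable_funM.
  apply: measurable_funX; apply: measurable_funB => //.
  exact: measurable_sum_tnth.
apply: measurable_prod => i _; apply: measurable_funX.
exact: measurable_tnth.
Qed.

Lemma dirichlet_monomial_ge0 m a g r (t : m.-tuple mR) :
  dilated_simplex r t -> 0 <= dirichlet_monomial a g r t.
Proof.
move=> [t0 tr]; apply: mulr_ge0; first by rewrite exprn_ge0// subr_ge0.
by apply: prodr_ge0 => i _; rewrite exprn_ge0.
Qed.

(** The multivariate beta function at integer arguments. The exponents [g] are indexed by [nat], so
    that the induction on [m] can shift them without casts. *)
Definition dirichlet_cst m (a : nat) (g : nat -> nat) : R :=
  (a`! * \prod_(i < m) (g i)`!)%:R / ((m + a + \sum_(i < m) g i)`!)%:R.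

Lemma tnth_tcons0 m (z : mR * m.-tuple mR) : tnth (tcons z) ord0 = z.1.
Proof. by []. Qed.

Lemma tnth_tconsS m (z : mR * m.-tuple mR) (i : 'I_m) :
  tnth (tcons z) (lift ord0 i) = tnth z.2 i.
Proof. by rewrite /tcons tnthS. Qed.

(* [dilated_simplex] replaces [ref_simplex] because its slices are again dilated
   simplices, so that no change of variables is needed. *)
Lemma integral_dirichlet m a g (r : R) : 0 <= r ->
  (\int[lebesgue_tuple m]_(t in dilated_simplex r)
      (dirichlet_monomial a g r t)%:E)%E
  = (dirichlet_cst m a g * r ^+ (m + a + \sum_(i < m) g i))%:E.
Proof.
elim: m g r => [|m IH] g r r0.
  have mf : measurable_fun (@dilated_simplex 0 r)
      (fun t => (dirichlet_monomial a g r t)%:E).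
    apply/measurable_EFinP; apply: measurable_funTS.
    exact: measurable_dirichlet_monomial.
  rewrite /= integral_dirac//; last exact: measurable_dilated_simplex.
  rewrite diracE mem_set; last by split; [case|rewrite big_ord0].
  rewrite mul1e /dirichlet_monomial /dirichlet_cst !big_ord0 muln1 addn0 add0n.
  by rewrite subr0 mulr1 mulfV ?mul1r// pnatr_eq0 -lt0n fact_gt0.
pose mu := @lebesgue_tuple R m.
pose D : set (mR * m.-tuple mR) := @tcons R m @^-1` @dilated_simplex m.+1 r.
have mD : measurable D.
  rewrite /D -[X in measurable X]setTI.
  by apply: measurable_tcons => //; exact: measurable_dilated_simplex.
rewrite /= (@ge0_integral_pushforward _ _ _ _ _ _ (@measurable_tcons R m)); last 3 first.
- exact: measurable_dilated_simplex.
- apply/measurable_EFinP; apply: measurable_funTS.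
  exact: measurable_dirichlet_monomial.
- by move=> t; rewrite inE => ?; rewrite lee_fin dirichlet_monomial_ge0.
rewrite -/D integral_mkcond.
rewrite (fubini_tonelli1 (m1 := lebesgue_measure) (m2 := mu)); last 2 first.
- apply/measurable_restrict => //; rewrite setTI.
  apply: measurable_funTS; apply/measurable_EFinP.
  apply: measurableT_comp; first exact: measurable_dirichlet_monomial.
  exact: measurable_tcons.
- move=> z; apply: erestrict_ge0 => {}z Dz.
  by rewrite lee_fin dirichlet_monomial_ge0.
pose g' i := g i.+1.
(* The inner integral is homogeneous of degree [N] in [r - x], which leaves a beta integral in the
   first coordinate [x]. *)
pose N := (m + a + \sum_(i < m) g' i)%N.
transitivity (\int[lebesgue_measure]_(x in `[0%R, r])
    ((dirichlet_cst m a g')%:E * (x ^+ g 0%N * (r - x) ^+ N)%:E))%E.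
  rewrite [RHS]integral_mkcond; apply: eq_integral => x _.
  rewrite /fubini_F [RHS]patchE; case: ifPn => [|xr]; last first.
    apply: integral0_eq => t _; rewrite patchE memNset//= => -[t0 tr].
    move: xr; rewrite notin_setE/= in_itv/=; apply; apply/andP; split.
      by have := t0 ord0.
    apply: le_trans tr; rewrite big_ord_recl tnth_tcons0/= lerDl sumr_ge0//.
  rewrite inE/= in_itv/= => /andP[x0 xr].
  have rx0 : 0 <= r - x by rewrite subr_ge0.
  transitivity (\int[mu]_t ((x ^+ g 0%N)%:E *
     ((fun t => (dirichlet_monomial a g' (r - x) t)%:E) \_ (dilated_simplex (r - x))) t))%E.
    apply: eq_integral => t _; rewrite !patchE.
    have -> : ((x, t) \in D) = (t \in @dilated_simplex m (r - x)).
      apply/idP/idP; rewrite !inE => -[t0 tr]; split.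
      - by move=> i; have := t0 (lift ord0 i); rewrite tnth_tconsS.
      - move: tr; rewrite big_ord_recl tnth_tcons0/= lerBrDl; congr (_ + _ <= _).
        by apply: eq_bigr => i _; rewrite tnth_tconsS.
      - by move=> i; case: (unliftP ord0 i) => [j|] ->; rewrite ?tnth_tconsS ?tnth_tcons0.
      - rewrite big_ord_recl tnth_tcons0/= -lerBrDl; congr (_ <= _): tr.
        by apply: eq_bigr => i _; rewrite tnth_tconsS.
    case: ifP => _; last by rewrite mule0.
    rewrite /= -EFinM /dirichlet_monomial !big_ord_recl tnth_tcons0/=.
    under [X in _ * (_ * X)]eq_bigr do rewrite tnth_tconsS.
    under [in LHS]eq_bigr do rewrite tnth_tconsS.
    by rewrite opprD addrA mulrCA.
  rewrite ge0_integralZl//; last 3 first.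
  - apply/measurable_restrict => //; first exact: measurable_dilated_simplex.
    apply: measurable_funTS; apply/measurable_EFinP.
    exact: measurable_dirichlet_monomial.
  - move=> t _; apply: erestrict_ge0 => {}t ?.
    by rewrite lee_fin dirichlet_monomial_ge0.
  - by rewrite lee_fin exprn_ge0.
  rewrite -integral_mkcond IH// -/N -!EFinM; congr EFin.
  by rewrite mulrCA.
rewrite ge0_integralZl//; last 3 first.
- apply/measurable_EFinP; apply: measurable_funM.
    by apply: measurable_funX.
  by apply: measurable_funX; apply: measurable_funB.
- move=> x; rewrite /= in_itv/= => /andP[x0 xr]; rewrite lee_fin.
  by rewrite mulr_ge0// exprn_ge0// subr_ge0.
- by rewrite lee_fin divr_ge0.
rewrite integral_beta// -EFinM; congr EFin.
rewrite /dirichlet_cst !big_ord_recl /= -/(g' _).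
have -> : (m.+1 + a + (g 0%N + \sum_(i < m) g (bump 0 i)))%N = (g 0%N + N).+1.
  by rewrite /N /g' /bump/= !addSn addnCA.
rewrite mulrA; congr (_ * _).
rewrite (eq_bigr (fun i : 'I_m => (g' i)`!)) //.
move: (fact_gt0 N) (fact_gt0 (g 0%N + N).+1) => N0; rewrite -/N.
move: (_.+1)`! (N`!) N0 => N1 N2 N20 N10.
rewrite !natrM; field.
by rewrite !pnatr_eq0 -!lt0n N10 N20.
Qed.

End Dirichlet.

(** * Polynomial functions *)

Section Polynomials.
Context {R : realType} {dim : nat}.
Notation point := 'rV[R]_dim.
Implicit Types (f g : point -> R).

Definition monomial (e : 'I_dim -> nat) (x : point) : R := \prod_i x 0 i ^+ e i.

Lemma is_poly_monomial m e : (\sum_i e i <= m)%N -> is_poly m (monomial e).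
Proof.
move=> em.
have ltm i : (e i < m.+1)%N.
  by rewrite ltnS; apply: leq_trans em; rewrite (bigD1 i)//= leq_addr.
pose e' : @exponent dim m := [ffun i => Ordinal (ltm i)].
exists (fun k => (k == e')%:R) => x; rewrite /polyval (bigD1 e')/=; last first.
  by under eq_bigr do rewrite ffunE /=.
rewrite eqxx mul1r [X in _ + X]big1 ?addr0; last first.
  by move=> k /andP[_ /negbTE ->]; rewrite mul0r.
by apply: eq_bigr => i _; rewrite ffunE.
Qed.

Lemma is_poly0 m : is_poly m (fun _ : point => 0).
Proof.
by exists (fun _ => 0) => x; rewrite /polyval big1// => e _; rewrite mul0r.
Qed.

Lemma is_polyD m f g :
  is_poly m f -> is_poly m g -> is_poly m (fun x => f x + g x).
Proof.
move=> [a fa] [b gb]; exists (fun e => a e + b e) => x.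
by rewrite fa gb -big_split/=; apply: eq_bigr => e _; rewrite mulrDl.
Qed.

Lemma is_polyZ m c f : is_poly m f -> is_poly m (fun x => c * f x).
Proof.
move=> [a fa]; exists (fun e => c * a e) => x.
by rewrite fa mulr_sumr; apply: eq_bigr => e _; rewrite mulrA.
Qed.

Lemma is_poly_sum m (I : Type) (r : seq I) (Q : pred I) (F : I -> point -> R) :
  (forall i, Q i -> is_poly m (F i)) ->
  is_poly m (fun x => \sum_(i <- r | Q i) F i x).
Proof.
move=> Fm; elim: r => [|i r IH].
  by under eq_fun do rewrite big_nil; exact: is_poly0.
case Qi : (Q i); last by under eq_fun do rewrite big_cons Qi.
by under eq_fun do rewrite big_cons Qi; apply: is_polyD; [exact: Fm|].
Qed.

(** This removes the coefficient families with bounded exponents from all later arguments, which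
    treat one monomial with exponents in [nat] at a time. *)
Lemma is_poly_ind (Phi : (point -> R) -> Prop) m :
  Phi (fun=> 0) ->
  (forall f c e, (\sum_i e i <= m)%N -> Phi f ->
    Phi (fun x => c * monomial e x + f x)) ->
  forall f, is_poly m f -> Phi f.
Proof.
move=> Phi0 PhiS f [a fa].
have -> : f = polyval a by apply/funext.
rewrite /polyval; elim: (index_enum _) => [|k r IH].
  by under eq_fun do rewrite big_nil.
case: (boolP (\sum_i k i <= m)%N) => km; last first.
  by under eq_fun do rewrite big_cons (negbTE km).
under eq_fun do rewrite big_cons km.
exact: (@PhiS _ (a k) (fun i => k i)).
Qed.

Lemma is_polyW m n f : (m <= n)%N -> is_poly m f -> is_poly n f.
Proof.
move=> mn; apply: (is_poly_ind (Phi := is_poly n)); first exact: is_poly0.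
move=> g c e em ng; apply: is_polyD => //; apply: is_polyZ.
by apply: is_poly_monomial; exact: leq_trans em mn.
Qed.

Lemma is_poly_cst m c : is_poly m (fun _ : point => c).
Proof.
have : is_poly m (fun x : point => c * monomial (fun=> 0%N) x).
  by apply: is_polyZ; apply: is_poly_monomial; rewrite big1.
congr is_poly; apply/funext => x; rewrite /monomial big1 ?mulr1//.
Qed.

Lemma is_polyM m n f g :
  is_poly m f -> is_poly n g -> is_poly (m + n) (fun x => f x * g x).
Proof.
move=> fm gn; move: f fm; apply: is_poly_ind.
  by under eq_fun do rewrite mul0r; exact: is_poly0.
move=> f c e em fg; under eq_fun do rewrite mulrDl.
apply: is_polyD => //; under eq_fun do rewrite -mulrA; apply: is_polyZ.
move: g gn {fg}; apply: is_poly_ind.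
  by under eq_fun do rewrite mulr0; exact: is_poly0.
move=> g c' e' en IH; under eq_fun do rewrite mulrDr.
apply: is_polyD => //; under eq_fun do rewrite mulrCA; apply: is_polyZ.
have : is_poly (m + n) (monomial (fun i => e i + e' i)%N).
  by apply: is_poly_monomial; rewrite big_split leq_add.
congr is_poly; apply/funext => x; rewrite /monomial -big_split/=.
by apply: eq_bigr => i _; rewrite exprD.
Qed.

Lemma is_poly_coord i : is_poly 1 (fun x : point => x 0 i).
Proof.
have : is_poly 1 (monomial (fun j => nat_of_bool (j == i))).
  apply: is_poly_monomial; rewrite (bigD1 i)//= eqxx big1 ?addn0//.
  by move=> j /negbTE ->.
congr is_poly; apply/funext => x; rewrite /monomial (bigD1 i)//= eqxx expr1.
by rewrite big1 ?mulr1// => j /negbTE ->; rewrite expr0.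
Qed.

(** The degree matters only for membership in the discrete spaces; integrability and
    differentiability need no bound on it. *)
Definition polyfun f := exists m, is_poly m f.

Lemma is_poly_polyfun m f : is_poly m f -> polyfun f.
Proof. by exists m. Qed.

Lemma polyfun_cst c : polyfun (fun=> c).
Proof. by exists 0%N; exact: is_poly_cst. Qed.

Lemma polyfunD f g : polyfun f -> polyfun g -> polyfun (fun x => f x + g x).
Proof.
move=> [m fm] [n gn]; exists (maxn m n); apply: is_polyD.
  by apply: is_polyW fm; rewrite leq_maxl.
by apply: is_polyW gn; rewrite leq_maxr.
Qed.

Lemma polyfunM f g : polyfun f -> polyfun g -> polyfun (fun x => f x * g x).
Proof. by move=> [m fm] [n gn]; exists (m + n)%N; exact: is_polyM. Qed.

Lemma polyfun_coord i : polyfun (fun x => x 0 i).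
Proof. by exists 1%N; exact: is_poly_coord. Qed.

Lemma polyfun_sum (I : Type) (r : seq I) (Q : pred I) (F : I -> point -> R) :
  (forall i, Q i -> polyfun (F i)) -> polyfun (fun x => \sum_(i <- r | Q i) F i x).
Proof.
move=> Fm; elim: r => [|i r IH].
  by under eq_fun do rewrite big_nil; exact: polyfun_cst.
case Qi : (Q i); last by under eq_fun do rewrite big_cons Qi.
by under eq_fun do rewrite big_cons Qi; apply: polyfunD; [exact: Fm|].
Qed.

Lemma polyfunX f n : polyfun f -> polyfun (fun x => f x ^+ n).
Proof.
move=> fp; elim: n => [|n IH]; first exact: polyfun_cst.
by under eq_fun do rewrite exprS; exact: polyfunM.
Qed.

Lemma polyfun_prod (I : Type) (r : seq I) (Q : pred I) (F : I -> point -> R) :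
  (forall i, Q i -> polyfun (F i)) -> polyfun (fun x => \prod_(i <- r | Q i) F i x).
Proof.
move=> Fm; elim: r => [|i r IH].
  by under eq_fun do rewrite big_nil; exact: polyfun_cst.
case Qi : (Q i); last by under eq_fun do rewrite big_cons Qi.
by under eq_fun do rewrite big_cons Qi; apply: polyfunM; [exact: Fm|].
Qed.

Lemma is_derive_affine f x v d :
  (forall h, f (h *: v + x) = f x + h * d) -> is_derive x v f d.
Proof.
move=> fd.
have cv : (fun h : R => h^-1 *: ((f \o shift x) (h *: v) - f x)) @ 0^' --> d.
  apply: (@cvg_trans _ ((fun=> d) @ (0 : R)^')); last exact: cvg_cst.
  apply: near_eq_cvg; near=> h.
  rewrite /= fd addrAC subrr add0r /GRing.scale/= mulrA mulVf ?mul1r//.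
  by near: h; exact: nbhs_dnbhs_neq.
by apply: DeriveDef; [apply/cvg_ex; exists d|exact: cvg_lim].
Unshelve. all: by end_near. Qed.

Lemma is_derive_coord x v i : is_derive x v (fun y : point => y 0 i) (v 0 i).
Proof. by apply: is_derive_affine => h; rewrite !mxE addrC. Qed.

(** The factors are arbitrary differentiable functions because the rule serves for Cartesian and for
    barycentric coordinates. The truncation of [e i - 1] at [e i = 0] is harmless, since the factor
    [e i] is then 0. *)
Lemma is_derive_monomial (I : eqType) (r : seq I) (h : I -> point -> R)
    (d : I -> R) (e : I -> nat) x v : uniq r ->
  (forall i, is_derive x v (h i) (d i)) ->
  is_derive x v (fun y => \prod_(i <- r) h i y ^+ e i)
    (\sum_(i <- r) d i * (e i)%:R * \prod_(j <- r) h j x ^+ (e j - (j == i))).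
Proof.
move=> + hd; elim: r => [_|a r IH /= /andP[ar /IH {}IH]].
  by under eq_fun do rewrite big_nil; rewrite big_nil; exact: is_derive_cst.
have D := is_deriveM (is_deriveX (e a) (hd a)) IH.
rewrite (_ : (fun y => _) =
    h a ^+ e a * (fun y => \prod_(i <- r) h i y ^+ e i)); last first.
  by apply/funext => y; rewrite big_cons !fctE.
apply: is_derive_eq.
rewrite big_cons addrC; congr (_ + _).
  rewrite big_cons eqxx subn1 /GRing.scale/=.
  under [X in _ = _ * (_ * X)]eq_big_seq => j jr.
    rewrite (_ : j == a = false) ?subn0; last by apply: contraNF ar => /eqP <-.
    over.
  by rewrite /=; ring.
rewrite /GRing.scale/= mulr_sumr; apply: eq_big_seq => j jr.
rewrite big_cons (_ : a == j = false) ?subn0; last by apply: contraNF ar => /eqP ->.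
by rewrite fctE mulrCA.
Qed.

Lemma polyfun_derivable f x v : polyfun f -> derivable f x v.
Proof.
case=> m; move: f; apply: is_poly_ind; first exact: derivable_cst.
move=> f c e _ df; apply: derivableD; last exact: df.
apply: derivableM; first exact: derivable_cst.
by case: (is_derive_monomial e (index_enum_uniq _) (is_derive_coord x v)).
Qed.

Lemma is_poly_derive m f v : is_poly m f -> is_poly m.-1 (fun x => 'D_v f x).
Proof.
(* Differentiability of the partial sum is carried along, because the derivative of a sum splits
   only for differentiable summands. *)
move=> fm; suff [] : polyfun f /\ is_poly m.-1 (fun x => 'D_v f x) by [].
move: f fm; apply: is_poly_ind.
  split; first exact: polyfun_cst.
  by under eq_fun do rewrite derive_cst; exact: is_poly0.
move=> f c e em [fp fd]; have mp : polyfun (monomial e).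
  exact: is_poly_polyfun (is_poly_monomial em).
split.
  by apply: polyfunD => //; apply: polyfunM => //; exact: polyfun_cst.
have -> : (fun x => 'D_v (fun y => c * monomial e y + f y) x) =
    (fun x => c * 'D_v (monomial e) x + 'D_v f x).
  apply/funext => x.
  rewrite deriveD; [|exact: polyfun_derivable (polyfunM (polyfun_cst c) mp)
                    |exact: polyfun_derivable].
  by rewrite (@deriveZ _ _ _ (monomial e))//; exact: polyfun_derivable.
apply: is_polyD => //; apply: is_polyZ.
have -> : (fun x => 'D_v (monomial e) x) = (fun x => \sum_i
    v 0 i * (e i)%:R * monomial (fun j => e j - (j == i))%N x).
  apply/funext => x.
  have D := is_derive_monomial e (index_enum_uniq _) (is_derive_coord x v).
  by rewrite derive_val.
(* For [e i = 0] the truncated exponent would not lower the degree, but the coefficient vanishes. *)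
apply: is_poly_sum => i _; have [ei0|ei0] := posnP (e i).
  by under eq_fun do rewrite ei0 mulr0 mul0r; exact: is_poly0.
apply: is_polyZ; apply: is_poly_monomial.
rewrite -ltnS prednK; last by apply: leq_trans em; rewrite (bigD1 i)//= ltn_addr.
apply: leq_trans em; rewrite (bigD1 i)//= [X in (_ < X)%N](bigD1 i)//= eqxx.
rewrite subn1 -addSn prednK// leq_add2l; apply: leq_sum => j _.
exact: leq_subr.
Qed.

Lemma polyfun_derive f v : polyfun f -> polyfun (fun x => 'D_v f x).
Proof. by case=> m /(is_poly_derive v); exists m.-1. Qed.

(** Since [0.-1 = 0], the degree count of [is_poly_derive] does not see that constants have
    derivative 0; repeated differentiation needs this as its base case. *)
Lemma derive_is_poly0 f v : is_poly 0 f -> (fun x => 'D_v f x) = (fun=> 0).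
Proof.
move=> [a fa]; have -> : f = (fun=> f 0).
  apply/funext => x; rewrite !fa; apply: eq_bigr => e e0; congr (_ * _).
  apply: eq_bigr => i _; suff -> : e i = 0%N :> nat by rewrite !expr0.
  by apply/eqP; rewrite -leqn0 -ltnS ltn_ord.
by apply/funext => x; rewrite derive_cst.
Qed.

End Polynomials.

(** * Integration over simplices *)

Section SimplexIntegral.
Context {R : realType} {dim : nat} {V : finType} (pos : V -> 'rV[R]_dim).
Local Notation mR := (measurableTypeR R).
Notation point := 'rV[R]_dim.
Implicit Types (S : {set V}) (f g : point -> R).

Lemma measurable_ref_simplex m : measurable (@ref_simplex R m).
Proof. exact: measurable_dilated_simplex. Qed.

Lemma integral_ref_simplex_dirichlet m a (g : nat -> nat) :
  (\int[@lebesgue_tuple R m]_(t in @ref_simplex R m)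
     ((1 - \sum_i tnth t i) ^+ a * \prod_(i < m) tnth t i ^+ g i)%:E)%E
  = (@dirichlet_cst R m a g)%:E.
Proof. by have := @integral_dirichlet R m a g 1 ler01; rewrite expr1n mulr1. Qed.

(** With all exponents 0 the Dirichlet formula gives the volume of the reference simplex,
    [1 / m!]. *)
Lemma ref_simplex_finite m : (@lebesgue_tuple R m (@ref_simplex R m) < +oo)%E.
Proof.
have := @integral_ref_simplex_dirichlet m 0 (fun=> 0%N).
under eq_integral do rewrite expr0 mul1r big1 //.
rewrite integral_cst ?mul1e; last exact: measurable_ref_simplex.
by move=> ->; rewrite ltry.
Qed.

Definition simplex_integrable m S g : Prop :=
  (@lebesgue_tuple R m).-integrable (@ref_simplex R m)
    (EFin \o (fun t => g (param pos S t))).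

Lemma simplex_integrableD m S f g : simplex_integrable m S f ->
  simplex_integrable m S g -> simplex_integrable m S (fun x => f x + g x).
Proof.
move=> fi gi; have := integrableD (@measurable_ref_simplex m) fi gi.
by apply: eq_integrable; [exact: measurable_ref_simplex|].
Qed.

Lemma simplex_integrableZ m S c g : simplex_integrable m S g ->
  simplex_integrable m S (fun x => c * g x).
Proof.
move=> gi; have := integrableZl (@measurable_ref_simplex m) c gi.
by apply: eq_integrable; [exact: measurable_ref_simplex|].
Qed.

Lemma simplex_intD m S f g : simplex_integrable m S f ->
  simplex_integrable m S g ->
  simplex_int pos m S (fun x => f x + g x) =
    simplex_int pos m S f + simplex_int pos m S g.
Proof.
move=> fi gi; rewrite /simplex_int -mulrDr; congr (_ * _).
by rewrite -RintegralD//; exact: measurable_ref_simplex.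
Qed.

Lemma simplex_intZ m S c g : simplex_integrable m S g ->
  simplex_int pos m S (fun x => c * g x) = c * simplex_int pos m S g.
Proof.
move=> gi; rewrite /simplex_int mulrCA; congr (_ * _).
by rewrite -RintegralZl//; exact: measurable_ref_simplex.
Qed.

Lemma simplex_integrableB m S f g : simplex_integrable m S f ->
  simplex_integrable m S g -> simplex_integrable m S (fun x => f x - g x).
Proof.
move=> fi gi; under eq_fun do rewrite -mulN1r.
by apply: simplex_integrableD => //; exact: simplex_integrableZ.
Qed.

Lemma simplex_intB m S f g : simplex_integrable m S f ->
  simplex_integrable m S g ->
  simplex_int pos m S (fun x => f x - g x) =
    simplex_int pos m S f - simplex_int pos m S g.
Proof.
move=> fi gi; under [in LHS]eq_fun do rewrite -mulN1r.
by rewrite simplex_intD ?simplex_intZ ?mulN1r//; exact: simplex_integrableZ.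
Qed.

Lemma simplex_int0 m S : simplex_int pos m S (fun=> 0) = 0.
Proof.
rewrite /simplex_int (_ : \int[_]_(_ in _) _ = 0) ?mulr0//.
by rewrite /Rintegral integral0.
Qed.

Lemma simplex_integrable0 m S : simplex_integrable m S (fun=> 0).
Proof. exact: integrable0. Qed.

Lemma simplex_integrable_sum m S (I : Type) (r : seq I) (Q : pred I)
    (F : I -> point -> R) : (forall i, Q i -> simplex_integrable m S (F i)) ->
  simplex_integrable m S (fun x => \sum_(i <- r | Q i) F i x).
Proof.
move=> Fi; elim: r => [|i r IH].
  by under eq_fun do rewrite big_nil; exact: simplex_integrable0.
case Qi : (Q i); last by under eq_fun do rewrite big_cons Qi.
by under eq_fun do rewrite big_cons Qi; apply: simplex_integrableD; [exact: Fi|].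
Qed.

Lemma simplex_int_sum m S (I : Type) (r : seq I) (Q : pred I)
    (F : I -> point -> R) : (forall i, Q i -> simplex_integrable m S (F i)) ->
  simplex_int pos m S (fun x => \sum_(i <- r | Q i) F i x) =
  \sum_(i <- r | Q i) simplex_int pos m S (F i).
Proof.
move=> Fi; elim: r => [|i r IH].
  by under eq_fun do rewrite big_nil; rewrite big_nil simplex_int0.
rewrite big_cons; case Qi : (Q i); last by under eq_fun do rewrite big_cons Qi.
under eq_fun do rewrite big_cons Qi.
by rewrite simplex_intD ?IH//; [exact: Fi|exact: simplex_integrable_sum].
Qed.

Lemma simplex_int_ge0 m S g : (forall x, 0 <= g x) -> 0 <= simplex_int pos m S g.
Proof.
move=> g0; apply: mulr_ge0; first exact: sqrtr_ge0.
by apply: Rintegral_ge0.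
Qed.

Lemma eq_simplex_int_param m S f g :
  (forall t, @ref_simplex R m t -> f (param pos S t) = g (param pos S t)) ->
  simplex_int pos m S f = simplex_int pos m S g.
Proof.
move=> fg; rewrite /simplex_int; congr (_ * _); apply: eq_Rintegral => t.
by rewrite inE => /fg.
Qed.

Lemma svertex_mem m S i : #|S| = m.+1 -> (i <= m)%N ->
  exists2 v, v \in S & svertex pos S i = pos v.
Proof.
move=> Sm im; have [v0 _] : exists v, v \in S by apply/set0Pn; rewrite -card_gt0 Sm.
have ie : (i < size (enum S))%N by rewrite -cardE Sm ltnS.
exists (nth v0 (enum S) i); last by rewrite /svertex (nth_map v0).
by rewrite -mem_enum mem_nth.
Qed.

(** Barycentric coordinates on the reference simplex; index 0 belongs to the base vertex
    [svertex S 0] of [param]. *)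
Definition ref_bary m (t : m.-tuple mR) (i : nat) : R :=
  if i is j.+1 then nth 0 t j else 1 - \sum_i tnth t i.

Lemma sum_ref_bary m (t : m.-tuple mR) : \sum_(i < m.+1) ref_bary t i = 1.
Proof.
rewrite big_ord_recl/= [X in _ + X](_ : _ = \sum_i tnth t i) ?subrK//.
by apply: eq_bigr => i _; rewrite (tnth_nth 0).
Qed.

Lemma param_bary m S (t : m.-tuple mR) :
  param pos S t = \sum_(i < m.+1) ref_bary t i *: svertex pos S i.
Proof.
rewrite /param big_ord_recl/= scalerBl scale1r scaler_suml -addrA; congr (_ + _).
rewrite -sumrN -big_split/=; apply: eq_bigr => i _.
by rewrite scalerBr addrC (tnth_nth 0).
Qed.

Lemma ref_bary_ge0 m (t : m.-tuple mR) (i : nat) : ref_simplex t -> (i <= m)%N ->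
  0 <= ref_bary t i.
Proof.
move=> [t0 t1]; case: i => [|j jm]/=; first by rewrite subr_ge0.
by rewrite -(tnth_nth 0 t (Ordinal jm)).
Qed.

Lemma sum_enum_index m S (T : zmodType) (v0 : V) (F : nat -> V -> T) :
  #|S| = m.+1 ->
  \sum_(v in S) F (index v (enum S)) v = \sum_(i < m.+1) F i (nth v0 (enum S) i).
Proof.
move=> Sm; rewrite -big_enum/= (big_nth v0) -cardE Sm big_mkord.
by apply: eq_bigr => i _; rewrite index_uniq ?enum_uniq// -cardE Sm.
Qed.

Lemma sum_ref_bary_index m S (t : m.-tuple mR) : #|S| = m.+1 ->
  \sum_(v in S) ref_bary t (index v (enum S)) = 1.
Proof.
move=> Sm; have [v0 _] : exists v, v \in S.
  by apply/set0Pn; rewrite -card_gt0 Sm.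
by rewrite (sum_enum_index v0 (fun i _ => ref_bary t i) Sm) sum_ref_bary.
Qed.

Lemma param_combination m S (t : m.-tuple mR) : #|S| = m.+1 ->
  param pos S t = \sum_(v in S) ref_bary t (index v (enum S)) *: pos v.
Proof.
move=> Sm; have [v0 _] : exists v, v \in S.
  by apply/set0Pn; rewrite -card_gt0 Sm.
rewrite (sum_enum_index v0 (fun i v => ref_bary t i *: pos v) Sm) param_bary.
apply: eq_bigr => i _; congr (_ *: _).
by rewrite /svertex (nth_map v0)// -cardE Sm.
Qed.

Lemma param_hull m S (t : m.-tuple mR) : #|S| = m.+1 -> ref_simplex t ->
  hull pos S (param pos S t).
Proof.
move=> Sm t1; exists (fun v => ref_bary t (index v (enum S))); split.
- move=> v vS; apply: ref_bary_ge0 => //.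
  by rewrite -ltnS -Sm cardE index_mem mem_enum.
- exact: sum_ref_bary_index.
- exact: param_combination.
Qed.

Lemma eq_simplex_int m S f g : #|S| = m.+1 ->
  (forall x, hull pos S x -> f x = g x) ->
  simplex_int pos m S f = simplex_int pos m S g.
Proof.
by move=> Sm fg; apply: eq_simplex_int_param => t /(param_hull Sm)/fg.
Qed.

(** A class of test functions stable under products, as integrable functions are not. Only values on
    the simplex count, so that it contains polynomials as well as facet functions that are
    polynomial on the facet alone. *)
Definition simplex_bounded m S g : Prop :=
  measurable_fun (@ref_simplex R m) (fun t => g (param pos S t)) /\
  exists B, forall t, @ref_simplex R m t -> `|g (param pos S t)| <= B.

Lemma simplex_boundedD m S f g : simplex_bounded m S f ->
  simplex_bounded m S g -> simplex_bounded m S (fun x => f x + g x).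
Proof.
move=> [mf [B fB]] [mg [C gC]]; split; first exact: measurable_funD.
exists (B + C) => t st; apply: le_trans (ler_normD _ _) _.
by rewrite lerD ?fB ?gC.
Qed.

Lemma simplex_boundedM m S f g : simplex_bounded m S f ->
  simplex_bounded m S g -> simplex_bounded m S (fun x => f x * g x).
Proof.
move=> [mf [B fB]] [mg [C gC]]; split; first exact: measurable_funM.
exists (B * C) => t st; rewrite normrM.
by rewrite ler_pM ?fB ?gC.
Qed.

Lemma simplex_bounded_cst m S c : simplex_bounded m S (fun=> c).
Proof. by split; [exact: measurable_cst|exists `|c|]. Qed.

Lemma simplex_bounded_coord m S j : simplex_bounded m S (fun x => x 0 j).
Proof.
split.
  have -> : (fun t : m.-tuple mR => param pos S t 0 j) = (fun t =>
      svertex pos S 0 0 j + \sum_(i < m)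
        tnth t i * (svertex pos S i.+1 - svertex pos S 0) 0 j).
    apply/funext => t; rewrite /param mxE summxE; congr (_ + _).
    by apply: eq_bigr => i _; rewrite mxE.
  apply: measurable_funTS; apply: measurable_funD => //.
  apply: measurable_sum => i; apply: measurable_funM => //.
  exact: measurable_tnth.
exists (\sum_(i < m.+1) `|svertex pos S i 0 j|) => t st.
rewrite param_bary summxE; apply: le_trans (ler_norm_sum _ _ _) _.
apply: ler_sum => i _; rewrite mxE normrM ler_piMl//.
have t0 (k : 'I_m.+1) : 0 <= ref_bary t k by apply: ref_bary_ge0; rewrite -1?ltnS.
rewrite ger0_norm// -[X in _ <= X](sum_ref_bary t) (bigD1 i)//= lerDl.
by apply: sumr_ge0.
Qed.

Lemma polyfun_bounded m S g : polyfun g -> simplex_bounded m S g.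
Proof.
case=> n; move: g; apply: is_poly_ind; first exact: simplex_bounded_cst.
move=> g c e _ gb; apply: simplex_boundedD => //.
apply: simplex_boundedM; first exact: simplex_bounded_cst.
rewrite /monomial; elim: (index_enum _) => [|i r IH].
  by under eq_fun do rewrite big_nil; exact: simplex_bounded_cst.
under eq_fun do rewrite big_cons; apply: simplex_boundedM => //.
elim: (e i) => [|k IHk]; first exact: simplex_bounded_cst.
under eq_fun do rewrite exprS; apply: simplex_boundedM => //.
exact: simplex_bounded_coord.
Qed.

Lemma simplex_bounded_integrable m S g :
  simplex_bounded m S g -> simplex_integrable m S g.
Proof.
move=> [mg [B gB]]; apply: measurable_bounded_integrable => //.
- exact: measurable_ref_simplex.
- exact: ref_simplex_finite.
- exists B; split; first exact: num_real.
  by move=> C BC t /gB /= gt; exact: le_trans gt (ltW BC).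
Qed.

Lemma polyfun_integrable m S g : polyfun g -> simplex_integrable m S g.
Proof. by move=> gp; exact/simplex_bounded_integrable/polyfun_bounded. Qed.

Lemma simplex_bounded_L2 m S g : simplex_bounded m S g -> simplex_L2 pos m S g.
Proof.
move=> gb; split; first by case: gb.
under eq_fun do rewrite expr2.
exact: (simplex_bounded_integrable (simplex_boundedM gb gb)).
Qed.

(** Young's inequality gives [|f g| <= f^2 + g^2], and the bounded function [g] is square integrable
    because the reference simplex has finite measure. *)
Lemma simplex_L2_integrableM m S f g : simplex_L2 pos m S f ->
  simplex_bounded m S g -> simplex_integrable m S (fun x => f x * g x).
Proof.
move=> [mf f2] gb; have gi := simplex_bounded_integrable (simplex_boundedM gb gb).
have mS := @measurable_ref_simplex m.
have := integrableD mS f2 gi; apply: le_integrable => //.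
  apply/measurable_EFinP; apply: measurable_funM => //; by case: gb.
move=> t _; rewrite /= lee_fin normrM -expr2.
have := sqr_ge0 (`|f (param pos S t)| - `|g (param pos S t)|).
rewrite sqrrB !real_normK ?num_real// => h.
rewrite [X in _ <= X]ger0_norm ?addr_ge0 ?sqr_ge0//.
have := mulr_ge0 (normr_ge0 (f (param pos S t))) (normr_ge0 (g (param pos S t))).
by move: h; rewrite -mulr_natr; lra.
Qed.

Lemma simplex_L2_integrable m S f :
  simplex_L2 pos m S f -> simplex_integrable m S f.
Proof.
move=> f2; have := simplex_L2_integrableM f2 (simplex_bounded_cst m S 1).
by congr simplex_integrable; apply/funext => x; rewrite mulr1.
Qed.

(* Expanding the nonnegative quadratic [\int (s f + g)^2] in [s], which is affine
   when [\int f^2 = 0]. *)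
Lemma simplex_int_sqr_eq0 m S f g : simplex_L2 pos m S f ->
  simplex_bounded m S g -> simplex_int pos m S (fun x => f x ^+ 2) = 0 ->
  simplex_int pos m S (fun x => f x * g x) = 0.
Proof.
move=> f2 gb ff0; set I := simplex_int _ _ _ _.
pose J := simplex_int pos m S (fun x => g x * g x).
have h s : 0 <= 2 * s * I + J.
  have -> : 2 * s * I + J = simplex_int pos m S (fun x => (s * f x + g x) ^+ 2).
    have -> : (fun x => (s * f x + g x) ^+ 2) = (fun x =>
        s ^+ 2 * f x ^+ 2 + (2 * s * (f x * g x) + g x * g x)).
      by apply/funext => x; ring.
    have f2i : simplex_integrable m S (fun x => f x ^+ 2) by case: f2.
    have fgi := simplex_L2_integrableM f2 gb.
    have ggi := simplex_bounded_integrable (simplex_boundedM gb gb).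
    rewrite simplex_intD; [|exact: simplex_integrableZ|]; last first.
      by apply: simplex_integrableD => //; exact: simplex_integrableZ.
    rewrite simplex_intD//; last exact: simplex_integrableZ.
    by rewrite !simplex_intZ// ff0 mulr0 add0r.
  by apply: simplex_int_ge0 => x; exact: sqr_ge0.
(* For [I != 0] the affine function [2 s I + J] takes the value -1 at this [s]. *)
apply/eqP/negPn/negP => I0; have := h (- (J + 1) / (2 * I)).
suff -> : 2 * (- (J + 1) / (2 * I)) * I + J = -1 by rewrite oppr_ge0 ler10.
by field.
Qed.

End SimplexIntegral.

Arguments polyfun_bounded {R dim V pos m S g}.
Arguments polyfun_integrable {R dim V pos m S g}.

(** * Barycentric coordinates *)

Section Geometry.
Context {R : realType}.

Section Dot.
Context {dim : nat}.
Implicit Types u v w : 'rV[R]_dim.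

Lemma dotC u v : dot u v = dot v u.
Proof. by apply: eq_bigr => i _; rewrite mulrC. Qed.

Lemma dotDl u v w : dot (u + v) w = dot u w + dot v w.
Proof. by rewrite /dot -big_split/=; apply: eq_bigr => i _; rewrite mxE mulrDl. Qed.

Lemma dotZl a u v : dot (a *: u) v = a * dot u v.
Proof. by rewrite /dot mulr_sumr; apply: eq_bigr => i _; rewrite mxE mulrA. Qed.

Lemma dotNl u v : dot (- u) v = - dot u v.
Proof. by rewrite -scaleN1r dotZl mulN1r. Qed.

Lemma dotBl u v w : dot (u - v) w = dot u w - dot v w.
Proof. by rewrite dotDl dotNl. Qed.

Lemma dot0l u : dot 0 u = 0.
Proof. by rewrite -(scale0r u) dotZl mul0r. Qed.

Lemma dot0r u : dot u 0 = 0.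
Proof. by rewrite dotC dot0l. Qed.

Lemma dot_suml (I : Type) (r : seq I) (Q : pred I) (F : I -> 'rV[R]_dim) w :
  dot (\sum_(i <- r | Q i) F i) w = \sum_(i <- r | Q i) dot (F i) w.
Proof.
by elim/big_rec2: _ => [|i x y _ <-]; [exact: dot0l|exact: dotDl].
Qed.

Lemma dot_ge0 u : 0 <= dot u u.
Proof. by apply: sumr_ge0 => i _; exact: sqr_ge0. Qed.

Lemma dot_delta j u : dot (delta_mx 0 j) u = u 0 j.
Proof.
rewrite /dot (bigD1 j)//= mxE !eqxx mul1r big1 ?addr0// => i /negbTE ij.
by rewrite mxE ij andbF mul0r.
Qed.

Lemma mulmx_trdot u v : u *m v^T = (dot u v)%:M.
Proof.
apply/matrixP => i j; rewrite !ord1 !mxE eqxx mulr1n.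
by apply: eq_bigr => k _; rewrite !mxE.
Qed.

End Dot.

Section Augmented.
Context {dim : nat}.
Implicit Types p q : nat -> 'rV[R]_dim.

(* Rows [(1, p i)]; permuting the points permutes its rows, which gives the
   independence of Gram determinants from the enumeration of the vertices. *)
Definition augmented p : 'M[R]_(1 + dim) :=
  \matrix_(i < 1 + dim) row_mx 1%:M (p i).

Lemma mulmx_augmented (c : 'rV_(1 + dim)) p :
  c *m augmented p = row_mx (\sum_i c 0 i)%:M (\sum_i c 0 i *: p i).
Proof.
rewrite mulmx_sum_row; under eq_bigr do rewrite rowK scale_row_mx.
apply/rowP => k; rewrite summxE; case: (split_ordP k) => j ->.
  rewrite row_mxEl !mxE ord1 eqxx mulr1n; apply: eq_bigr => i _.
  by rewrite row_mxEl !mxE eqxx mulr1.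
by rewrite row_mxEr summxE; apply: eq_bigr => i _; rewrite row_mxEr.
Qed.

(** Subtracting row 0 from the other rows is a factorization into a lower unipotent matrix and a
    block upper triangular one. *)
Lemma det_augmented p :
  \det (augmented p) = \det (\matrix_(i < dim) (p i.+1 - p 0%N)).
Proof.
have -> : augmented p =
    block_mx 1%:M 0 (const_mx 1) 1%:M *m
    block_mx 1%:M (p 0%N) 0 (\matrix_(i < dim) (p i.+1 - p 0%N)).
  rewrite mulmx_block !mul1mx !mul0mx !addr0.
  apply/row_matrixP => i; rewrite rowK.
  case: (split_ordP i) => j ->.
    by rewrite rowKu ord1 row_row_mx; congr row_mx; apply/rowP => k; rewrite !mxE.
  rewrite rowKd row_row_mx; congr row_mx; apply/rowP => k.
    by rewrite !mxE big_ord1 !mxE ord1 mul1r.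
  by rewrite !mxE big_ord1 !mxE mul1r addrC subrK.
by rewrite det_mulmx det_lblock det_ublock !det1 !mul1r.
Qed.

(** A permutation of the points changes the determinant by a sign, which the square removes; Gram
    determinants involve only the square. *)
Lemma sqr_det_augmented_perm p q :
  perm_eq [seq p i | i <- iota 0 dim.+1] [seq q i | i <- iota 0 dim.+1] ->
  \det (augmented p) ^+ 2 = \det (augmented q) ^+ 2.
Proof.
have sz (r : nat -> 'rV[R]_dim) : size [seq r i | i <- iota 0 dim.+1] == dim.+1.
  by rewrite size_map size_iota.
move=> pq; have /tuple_permP[s ps] : perm_eq (Tuple (sz p)) (Tuple (sz q)) by [].
have E : augmented p = row_perm s (augmented q).
  have pq_s (i : 'I_dim.+1) : p i = q (s i).
    have /(congr1 (fun t => nth 0 t i)) := ps; rewrite nth_mktuple (tnth_nth 0).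
    change (nth 0 (map p (iota 0 dim.+1)) i =
            nth 0 (map q (iota 0 dim.+1)) (s i) -> p i = q (s i)).
    by rewrite !(nth_map 0%N) ?size_iota// !nth_iota.
  by apply/matrixP => i j; rewrite [LHS]mxE [RHS]mxE [RHS]mxE pq_s.
rewrite E row_permE det_mulmx det_perm exprMn sqrr_sign mul1r//.
Qed.

Lemma sqr_det_gram m (A : 'M[R]_m) : \det (A *m A^T) = \det A ^+ 2.
Proof. by rewrite det_mulmx det_tr expr2. Qed.

End Augmented.

Section Barycentric.
Context {dim : nat} {V : finType} (pos : V -> 'rV[R]_dim).
Implicit Types (K : {set V}) (x y : 'rV[R]_dim).

(* [lam v] is the barycentric coordinate of vertex [v], [g v] its gradient. *)
Definition barycentric K (lam : V -> 'rV[R]_dim -> R) (g : V -> 'rV[R]_dim) :=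
  [/\ forall v w, v \in K -> w \in K -> lam v (pos w) = (v == w)%:R,
      forall x, \sum_(v in K) lam v x = 1,
      forall x, \sum_(v in K) lam v x *: pos v = x
    & forall v x y h, lam v (h *: y + x) = lam v x + h * dot y (g v)].

(** A row vector annihilated by the augmented matrix is an affine dependence: its weights sum to 0,
    and so does the weighted sum of the vertices. *)
Lemma det_edges_neq0 K : #|K| = dim.+1 -> affinely_independent pos K ->
  \det (edges pos dim K) != 0.
Proof.
move=> Kd Kaff; have [v0 v0K] : exists v, v \in K.
  by apply/set0Pn; rewrite -card_gt0 Kd.
rewrite -(det_augmented (svertex pos K)); apply/det0P => -[c c0 cA].
pose a v := c 0 (inord (index v (enum K))).
have sumE (T : zmodType) (F : 'I_(1 + dim) -> V -> T) :
    \sum_(v in K) F (inord (index v (enum K))) v =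
    \sum_(i < 1 + dim) F i (nth v0 (enum K) i).
  rewrite -big_enum/= (big_nth v0) -cardE Kd big_mkord; apply: eq_bigr => i _.
  by rewrite index_uniq ?enum_uniq -?cardE ?Kd// inord_val.
have sv (i : 'I_(1 + dim)) : svertex pos K i = pos (nth v0 (enum K) i).
  by rewrite /svertex (nth_map v0)// -cardE Kd.
move: cA; rewrite mulmx_augmented -row_mx0 => /eq_row_mx[c1 c2].
have a0 v : v \in K -> a v = 0.
  apply: (Kaff a).
    rewrite (sumE _ (fun i _ => c 0 i)).
    by have /matrixP/(_ 0 0) := c1; rewrite !mxE eqxx mulr1n.
  rewrite (sumE _ (fun i v => c 0 i *: pos v)) -[RHS]c2.
  by apply: eq_bigr => i _; rewrite sv.
case/eqP: c0; apply/rowP => i; rewrite mxE.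
have iK : (i < size (enum K))%N by rewrite -cardE Kd.
have := a0 (nth v0 (enum K) i); rewrite -mem_enum mem_nth// => /(_ isT).
by rewrite /a index_uniq ?enum_uniq// inord_val.
Qed.

(** The coordinates of [x] are the entries of [(1, x)] times the inverse of the augmented matrix;
    dropping the first row of that inverse leaves the gradients as columns. *)
Lemma barycentric_exists K : #|K| = dim.+1 -> affinely_independent pos K ->
  exists lam g, barycentric K lam g.
Proof.
move=> Kd Kaff; have [v0 v0K] : exists v, v \in K.
  by apply/set0Pn; rewrite -card_gt0 Kd.
have uA : augmented (svertex pos K) \in unitmx.
  rewrite unitmxE det_augmented unitfE; exact: det_edges_neq0.
pose B := invmx (augmented (svertex pos K)).
pose lam' (i : 'I_(1 + dim)) x : R := (row_mx 1%:M x *m B) 0 i.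
pose ix v : 'I_(1 + dim) := inord (index v (enum K)).
have sumE (T : zmodType) (F : 'I_(1 + dim) -> V -> T) :
    \sum_(v in K) F (ix v) v = \sum_(i < 1 + dim) F i (nth v0 (enum K) i).
  rewrite -big_enum/= (big_nth v0) -cardE Kd big_mkord; apply: eq_bigr => i _.
  by rewrite /ix index_uniq ?enum_uniq -?cardE ?Kd// inord_val.
have sv (i : 'I_(1 + dim)) : svertex pos K i = pos (nth v0 (enum K) i).
  by rewrite /svertex (nth_map v0)// -cardE Kd.
have ixK v : v \in K -> pos v = svertex pos K (ix v).
  move=> vK; rewrite sv /ix inordK ?nth_index ?mem_enum//.
  by rewrite -Kd cardE index_mem mem_enum.
have ix_inj v w : v \in K -> w \in K -> ix v = ix w -> v = w.
  move=> vK wK /(congr1 (@nat_of_ord _)); rewrite /ix !inordK; last 2 first.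
  - by rewrite -Kd cardE index_mem mem_enum.
  - by rewrite -Kd cardE index_mem mem_enum.
  by move=> /(congr1 (nth v0 (enum K))); rewrite !nth_index ?mem_enum.
have lamE x : row_mx 1%:M x =
    row_mx (\sum_i lam' i x)%:M (\sum_i lam' i x *: svertex pos K i).
  by rewrite -[LHS](mulmxKV uA) mulmx_augmented.
exists (fun v => lam' (ix v)), (fun v => \row_j B (rshift 1 j) (ix v)); split.
- move=> v w vK wK; rewrite (ixK w wK) /lam'.
  have -> : row_mx 1%:M (svertex pos K (ix w)) = row (ix w) (augmented (svertex pos K)).
    by rewrite rowK.
  rewrite -row_mul mulmxV// mxE mxE eq_sym; congr (nat_of_bool _)%:R.
  by apply/eqP/eqP => [/ix_inj ->|->].
- move=> x; rewrite (sumE _ (fun i _ => lam' i x)).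
  by have /eq_row_mx[/matrixP/(_ 0 0) + _] := lamE x; rewrite !mxE !eqxx.
- move=> x; rewrite (sumE _ (fun i v => lam' i x *: pos v)).
  have /eq_row_mx[_ {2}->] := lamE x.
  by apply: eq_bigr => i _; rewrite sv.
- move=> v x y h; rewrite /lam'.
  have -> : row_mx 1%:M (h *: y + x) = h *: row_mx 0 y + row_mx 1%:M x.
    by rewrite scale_row_mx scaler0 add_row_mx add0r.
  rewrite mulmxDl -scalemxAl mxE addrC; congr (_ + _).
  rewrite mxE; congr (_ * _); rewrite mxE big_split_ord/= big_ord1.
  rewrite row_mxEl mxE mul0r add0r; apply: eq_bigr => i _.
  by rewrite row_mxEr mxE.
Qed.

Section Coordinates.
Context {K : {set V}} {lam : V -> 'rV[R]_dim -> R} {g : V -> 'rV[R]_dim}.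
Hypothesis bK : barycentric K lam g.

Lemma lam_vertex v w : v \in K -> w \in K -> lam v (pos w) = (v == w)%:R.
Proof. by case: bK => + _ _ _; apply. Qed.

Lemma sum_lam x : \sum_(v in K) lam v x = 1.
Proof. by case: bK => _ + _ _; apply. Qed.

Lemma sum_lam_pos x : \sum_(v in K) lam v x *: pos v = x.
Proof. by case: bK => _ _ + _; apply. Qed.

Lemma lam_affine v x y h : lam v (h *: y + x) = lam v x + h * dot y (g v).
Proof. by case: bK => _ _ _; apply. Qed.

Lemma lamE v x : lam v x = lam v 0 + dot x (g v).
Proof. by have := lam_affine v 0 x 1; rewrite scale1r addr0 mul1r. Qed.

Lemma lamB v x y : lam v x - lam v y = dot (x - y) (g v).
Proof. by rewrite dotBl (lamE v x) (lamE v y); ring. Qed.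

Lemma sum_dot_grad y : \sum_(v in K) dot y (g v) = 0.
Proof.
have := sum_lam y; under eq_bigr do rewrite lamE.
rewrite big_split/= -[X in _ = X](sum_lam 0) => h.
by apply: (addrI (\sum_(v in K) lam v 0)); rewrite h addr0.
Qed.

Lemma lam_combination v (S : {set V}) (a : V -> R) : v \in K -> S \subset K ->
  \sum_(w in S) a w = 1 ->
  lam v (\sum_(w in S) a w *: pos w) = if v \in S then a v else 0.
Proof.
move=> vK SK a1; rewrite lamE dot_suml -[lam v 0]mul1r -a1 mulr_suml.
rewrite -big_split/= (eq_bigr (fun w => a w * (v == w)%:R)); last first.
  move=> w wS; rewrite dotZl -mulrDr -lamE lam_vertex//.
  exact: (fintype.subsetP SK).
case: ifPn => vS.
  rewrite (bigD1 v)//= eqxx mulr1 big1 ?addr0// => w /andP[_ /negbTE wv].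
  by rewrite eq_sym wv mulr0.
apply: big1 => w wS; case: eqP => [vw|]; last by rewrite mulr0.
by move: vS; rewrite vw wS.
Qed.

Lemma lam_hull_notin v (S : {set V}) x : v \in K -> S \subset K -> v \notin S ->
  hull pos S x -> lam v x = 0.
Proof.
by move=> vK SK /negbTE vS [a [_ a1 ->]]; rewrite lam_combination// vS.
Qed.

Lemma polyfun_lam v : polyfun (lam v).
Proof.
have -> : lam v = (fun x => lam v 0 + \sum_i x 0 i * g v 0 i).
  by apply/funext => x; rewrite lamE.
apply: polyfunD; first exact: polyfun_cst.
apply: polyfun_sum => i _; apply: polyfunM; last exact: polyfun_cst.
exact: polyfun_coord.
Qed.

Lemma is_derive_lam v x y : is_derive x y (lam v) (dot y (g v)).
Proof. by apply: is_derive_affine => h; rewrite lam_affine. Qed.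

End Coordinates.
End Barycentric.
End Geometry.

(** * Integrals of monomials in barycentric coordinates *)

Section BarycentricMonomials.
Context {R : realType} {dim : nat} {V : finType} (pos : V -> 'rV[R]_dim).
Local Notation mR := (measurableTypeR R).
Notation point := 'rV[R]_dim.
Context {K : {set V}} {lam : V -> point -> R} {g : V -> point}.
Hypothesis bK : barycentric pos K lam g.
Implicit Types (alpha : V -> nat) (f h : point -> R).

Definition bary_monomial alpha (x : point) : R := \prod_(v in K) lam v x ^+ alpha v.

(** Because [\sum_v lam v x = 1], coefficients of such expansions are not unique. The inductive form
    avoids choosing them and lets linear identities be proved one monomial at a time. *)
Inductive bary_span : (point -> R) -> Prop :=
| bary_span0 : bary_span (fun=> 0)
| bary_spanS f c alpha :
    bary_span f -> bary_span (fun x => c * bary_monomial alpha x + f x).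

Lemma bary_spanD f h : bary_span f -> bary_span h -> bary_span (fun x => f x + h x).
Proof.
move=> fs hs; elim: fs => [|{}f c a _ IH].
  by under eq_fun do rewrite add0r.
by under eq_fun do rewrite -addrA; exact: bary_spanS.
Qed.

Lemma bary_spanZ c f : bary_span f -> bary_span (fun x => c * f x).
Proof.
elim=> [|{}f c' a _ IH]; first by under eq_fun do rewrite mulr0; exact: bary_span0.
by under eq_fun do rewrite mulrDr mulrA; exact: bary_spanS.
Qed.

Lemma bary_span_monomial alpha : bary_span (bary_monomial alpha).
Proof.
have := bary_spanS 1 alpha bary_span0.
by congr bary_span; apply/funext => x; rewrite mul1r addr0.
Qed.

Lemma bary_spanM f h : bary_span f -> bary_span h -> bary_span (fun x => f x * h x).
Proof.
move=> fs hs; elim: fs => [|{}f c a _ IH].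
  by under eq_fun do rewrite mul0r; exact: bary_span0.
under eq_fun do rewrite mulrDl; apply: bary_spanD => //.
under eq_fun do rewrite -mulrA; apply: bary_spanZ.
elim: hs {IH} => [|{}h c' b _ IHh].
  by under eq_fun do rewrite mulr0; exact: bary_span0.
under eq_fun do rewrite mulrDr; apply: bary_spanD => //.
under eq_fun do rewrite mulrCA; apply: bary_spanZ.
have := bary_span_monomial (fun v => a v + b v)%N.
congr bary_span; apply/funext => x; rewrite /bary_monomial -big_split/=.
by apply: eq_bigr => v _; rewrite exprD.
Qed.

Lemma bary_span_cst c : bary_span (fun=> c).
Proof.
have := bary_spanZ c (bary_span_monomial (fun=> 0%N)).
by congr bary_span; apply/funext => x; rewrite /bary_monomial big1 ?mulr1.
Qed.

Lemma bary_span_lam v : v \in K -> bary_span (lam v).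
Proof.
move=> vK; have := bary_span_monomial (fun w => nat_of_bool (w == v)).
congr bary_span; apply/funext => x; rewrite /bary_monomial (bigD1 v)//=.
by rewrite eqxx big1 ?mulr1// => w /andP[_ /negbTE ->].
Qed.

Lemma bary_span_sum (I : Type) (r : seq I) (Q : pred I) (F : I -> point -> R) :
  (forall i, Q i -> bary_span (F i)) ->
  bary_span (fun x => \sum_(i <- r | Q i) F i x).
Proof.
move=> Fm; elim: r => [|i r IH].
  by under eq_fun do rewrite big_nil; exact: bary_span0.
case Qi : (Q i); last by under eq_fun do rewrite big_cons Qi.
by under eq_fun do rewrite big_cons Qi; apply: bary_spanD; [exact: Fm|].
Qed.

Lemma bary_span_coord j : bary_span (fun x => x 0 j).
Proof.
have -> : (fun x : point => x 0 j) = (fun x => \sum_(v in K) pos v 0 j * lam v x).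
  apply/funext => x; rewrite -{1}(sum_lam_pos bK x) summxE.
  by apply: eq_bigr => v _; rewrite mxE mulrC.
by apply: bary_span_sum => v vK; apply: bary_spanZ; exact: bary_span_lam.
Qed.

(** Each Cartesian coordinate is the combination [\sum_v pos v 0 j * lam v x], and the span is
    closed under products. *)
Lemma polyfun_bary_span f : polyfun f -> bary_span f.
Proof.
case=> m; move: f; apply: is_poly_ind; first exact: bary_span0.
move=> f c e _ fs; apply: bary_spanD => //; apply: bary_spanZ.
rewrite /monomial; elim: (index_enum _) => [|i r IH].
  by under eq_fun do rewrite big_nil; exact: bary_span_cst.
under eq_fun do rewrite big_cons; apply: bary_spanM => //.
elim: (e i) => [|k IHk]; first exact: bary_span_cst.
by under eq_fun do rewrite exprS; apply: bary_spanM => //; exact: bary_span_coord.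
Qed.

Lemma polyfun_bary_monomial alpha : polyfun (bary_monomial alpha).
Proof.
apply: polyfun_prod => v vK; apply: polyfunX; exact: polyfun_lam bK v.
Qed.

Lemma bary_span_polyfun f : bary_span f -> polyfun f.
Proof.
elim=> [|{}f c a _ fp]; first exact: polyfun_cst.
apply: polyfunD => //; apply: polyfunM; first exact: polyfun_cst.
exact: polyfun_bary_monomial.
Qed.

Lemma derive_bary_monomial alpha x y : 'D_y (bary_monomial alpha) x =
  \sum_(v in K) dot y (g v) * (alpha v)%:R *
    bary_monomial (fun w => alpha w - (w == v))%N x.
Proof.
have D := is_derive_monomial alpha (enum_uniq (mem K)) (fun v => is_derive_lam bK v x y).
have -> : bary_monomial alpha = (fun x => \prod_(v <- enum K) lam v x ^+ alpha v).
  by apply/funext => z; rewrite big_enum.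
rewrite derive_val big_enum/=; apply: eq_bigr => v _.
by rewrite big_enum.
Qed.

(** The factor in front of [simplex_int], that is [m!] times the [m]-dimensional measure of a
    simplex with [m.+1] vertices. *)
Definition gram m (S : {set V}) : R :=
  Num.sqrt (\det (edges pos m S *m (edges pos m S)^T)).

(** For a face [S] of [K] the coordinates [lam v] with [v \in S] restrict to the barycentric
    coordinates of [S], and [param] carries those of the reference simplex to them. Both cells
    ([S = K]) and facets are covered. *)
Lemma simplex_int_bary_monomial m (S : {set V}) alpha : #|S| = m.+1 -> S \subset K ->
  simplex_int pos m S (fun x => \prod_(v in S) lam v x ^+ alpha v) =
  gram m S * ((\prod_(v in S) (alpha v)`!)%:R / (m + \sum_(v in S) alpha v)`!%:R).
Proof.
move=> Sm SK; rewrite /simplex_int; congr (_ * _).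
have [v0 _] : exists v, v \in S by apply/set0Pn; rewrite -card_gt0 Sm.
pose w i := nth v0 (enum S) i.
have bigE (T : Type) (idx : T) (op : Monoid.com_law idx) (F : V -> T) :
    \big[op/idx]_(v in S) F v = \big[op/idx]_(i < m.+1) F (w i).
  by rewrite -big_enum/= (big_nth v0) -cardE Sm big_mkord.
have wS (i : 'I_m.+1) : w i \in S by rewrite -mem_enum mem_nth// -cardE Sm.
transitivity (dirichlet_cst m (alpha (w 0%N)) (fun i => alpha (w i.+1)) : R).
  suff E : (\int[@lebesgue_tuple R m]_(t in @ref_simplex R m)
      (\prod_(v in S) lam v (param pos S t) ^+ alpha v)%:E)%E =
      (dirichlet_cst m (alpha (w 0%N)) (fun i => alpha (w i.+1)))%:E.
    by rewrite /Rintegral E.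
  rewrite -integral_ref_simplex_dirichlet; apply: eq_integral => t; rewrite inE => st.
  congr EFin; rewrite bigE.
  have lw (i : 'I_m.+1) : lam (w i) (param pos S t) = ref_bary t i.
    rewrite param_combination//.
    rewrite (lam_combination bK)//; last exact: sum_ref_bary_index.
      by rewrite wS /w index_uniq ?enum_uniq// -cardE Sm.
    exact: (fintype.subsetP SK).
  under eq_bigr do rewrite lw.
  rewrite big_ord_recl/=; congr (_ * _); apply: eq_bigr => i _.
  by rewrite /= (tnth_nth 0).
rewrite /dirichlet_cst !bigE !big_ord_recl/= addnA.
by [].
Qed.

End BarycentricMonomials.

(** * The divergence theorem on a simplex *)

Section FacetGeometry.
Context {R : realType} {d : nat} {V : finType} (pos : V -> 'rV[R]_d.+1).
Notation point := 'rV[R]_d.+1.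

(** The property by which [outward_normal] selects its value; named so that existence can be proved
    and the selected vector be used only through it. *)
Definition is_outward_normal (K F : {set V}) (n : point) : Prop :=
  [/\ dot n n = 1,
    forall a b, a \in F -> b \in F -> dot n (pos a - pos b) = 0
    & forall v a, v \in K -> v \notin F -> a \in F ->
        dot n (pos v - pos a) < 0].

Lemma svertex_seq (S : {set V}) :
  [seq svertex pos S i | i <- iota 0 #|S|] = [seq pos v | v <- enum S].
Proof. rewrite cardE -(size_map pos); exact: mkseq_nth. Qed.

Context {K : {set V}} {lam : V -> point -> R} {g : V -> point}.
Hypotheses (Kd : #|K| = d.+2) (bK : barycentric pos K lam g).

Lemma facet_card v : v \in K -> #|K :\ v|%SET = d.+1.
Proof. by move=> vK; apply/eqP; rewrite -eqSS -Kd (cardsD1 v K) vK. Qed.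

(** The affine function [lam v] takes the value 1 at [v] and 0 at any other vertex of [K]. *)
Lemma grad_neq0 v : v \in K -> 0 < dot (g v) (g v).
Proof.
move=> vK; rewrite lt_neqAle dot_ge0 andbT eq_sym; apply/eqP => g0.
have [w wF] : exists w, w \in (K :\ v)%SET.
  by apply/set0Pn; rewrite -card_gt0 facet_card.
have [wv wK] : w != v /\ w \in K by move: wF; rewrite !inE => /andP.
have : g v = 0.
  apply/rowP => i; rewrite mxE; apply/eqP; rewrite -sqrf_eq0.
  have /eqP := g0; rewrite psumr_eq0; last by move=> j _; exact: sqr_ge0.
  by move=> /allP/(_ i (mem_index_enum _)).
move=> gv; have := lamB bK v (pos v) (pos w).
rewrite gv dot0r !(lam_vertex bK)// eqxx eq_sym (negbTE wv) subr0.
by move/eqP; rewrite oner_eq0.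
Qed.

Lemma exists_outward_normal v : v \in K ->
  exists n, is_outward_normal K (K :\ v)%SET n.
Proof.
move=> vK; have g0 := grad_neq0 vK; pose s := Num.sqrt (dot (g v) (g v)).
have s0 : 0 < s by rewrite sqrtr_gt0.
have ss : s ^+ 2 = dot (g v) (g v) by rewrite sqr_sqrtr// ltW.
exists (- s^-1 *: g v); split.
- by rewrite dotZl dotC dotZl -ss; field; exact: lt0r_neq0.
- move=> a b; rewrite !inE => /andP[av aK] /andP[bv bbK].
  rewrite dotZl dotC -(lamB bK) !(lam_vertex bK)//.
  by rewrite eq_sym (negbTE av) eq_sym (negbTE bv) subrr mulr0.
- move=> w a wK; rewrite !inE wK andbT negbK => /eqP -> /andP[av aK].
  rewrite dotZl dotC -(lamB bK) !(lam_vertex bK)// eqxx eq_sym (negbTE av).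
  by rewrite subr0 mulr1 oppr_lt0 invr_gt0.
Qed.

(* The unit normal is [- grad lam_v / |grad lam_v|], since both sides vanish on
   the edges of the facet, which with one further edge span the space. *)
Lemma outward_normalE v n : v \in K -> is_outward_normal K (K :\ v)%SET n ->
  exists c, [/\ 0 < c, c ^+ 2 * dot (g v) (g v) = 1 &
    forall y, dot y n = - c * dot y (g v)].
Proof.
move=> vK [nn nF nv]; have [w wF] : exists w, w \in (K :\ v)%SET.
  by apply/set0Pn; rewrite -card_gt0 facet_card.
have [wv wK] : w != v /\ w \in K by move: wF; rewrite !inE => /andP.
(* The distance from [v] to the plane of the opposite facet, which is the inverse length of
   [g v]. *)
pose c := - dot n (pos v - pos w).
have c0 : 0 < c by rewrite oppr_gt0; apply: nv => //; rewrite !inE eqxx.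
have nE y : dot y n = - c * dot y (g v).
  (* With the base point [w] on the facet, every term except [u = v] is a facet edge and therefore
     orthogonal to [n]. *)
  have yE : y = \sum_(u in K) dot y (g u) *: (pos u - pos w).
    under eq_bigr do rewrite scalerBr.
    rewrite sumrB -scaler_suml (sum_dot_grad bK) scale0r subr0.
    rewrite -[LHS](addrK 0) -{1}(scale1r y) -[1 *: y + 0](sum_lam_pos bK).
    rewrite -[X in _ - X](sum_lam_pos bK) -sumrB; apply: eq_bigr => u _.
    by rewrite -scalerBl (lam_affine bK) mul1r addrAC subrr add0r.
  rewrite [in LHS]yE dot_suml (bigD1 v)//= big1 ?addr0; last first.
    move=> u /andP[uK uv]; rewrite dotZl [dot (_ - _) n]dotC nF ?mulr0//.
    by rewrite !inE uv.
  by rewrite dotZl [dot (_ - _) n]dotC /c opprK mulrC.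
exists c; split => //.
by rewrite -nn nE dotC nE; ring.
Qed.

(** An enumeration of the vertices of a cell based at a vertex of the facet [F] and continued with
    the opposite vertex: its edge matrix is one edge to [v] above the edge matrix of [F]. *)
Definition facet_order (F : {set V}) v (i : nat) : point :=
  match i with
  | 0 => svertex pos F 0 | 1 => pos v | j.+2 => svertex pos F j.+1
  end.

Lemma sqr_det_facet_order v : v \in K ->
  \det (augmented (facet_order (K :\ v)%SET v)) ^+ 2 =
  \det (edges pos d.+1 K) ^+ 2.
Proof.
move=> vK; rewrite -(det_augmented (svertex pos K)).
apply: sqr_det_augmented_perm; set F := (K :\ v)%SET.
have Fd : #|F| = d.+1 by exact: facet_card.
have -> : [seq svertex pos K i | i <- iota 0 d.+2] = [seq pos v | v <- enum K].
  by rewrite -svertex_seq Kd.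
have -> : [seq facet_order F v i | i <- iota 0 d.+2] =
    svertex pos F 0 :: pos v :: [seq svertex pos F i | i <- iota 1 d].
  rewrite /=; congr (_ :: _ :: _).
  by rewrite (iotaDl 1 1) -map_comp; apply/eq_in_map => -[|j]; rewrite mem_iota.
have FE : [seq pos v | v <- enum F] = [seq svertex pos F i | i <- iota 0 d.+1].
  by rewrite -svertex_seq Fd.
rewrite (perm_catCA [:: _] [:: _]) /= -/(map _ (iota 0 d.+1)).
have -> : svertex pos F 0 :: [seq svertex pos F i | i <- iota 1 d] =
    [seq pos v | v <- enum F] by rewrite FE.
rewrite -(map_cons pos v); apply: perm_map; apply: uniq_perm.
- by rewrite /= enum_uniq mem_enum !inE eqxx.
- exact: enum_uniq.
- move=> u; rewrite inE !mem_enum !inE.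
  by case: eqP => // ->.
Qed.

Lemma gram_cell : gram pos d.+1 K = `|\det (edges pos d.+1 K)|.
Proof. by rewrite /gram sqr_det_gram sqrtr_sqr. Qed.

(** Let [E] be the facet edges, [e] an edge from the facet to [v], [A] the rows [e, E] and [N] the
    rows [g v, E]. From [E g = 0] and [e . g = 1] follow [det A * det N = det (E E^T)] and
    [det N ^ 2 = |g|^2 * det (E E^T)]. Hence [det N = |g|^2 * det A] and
    [det (E E^T) = |g|^2 * det A ^ 2]. *)
Lemma gram_facet v : v \in K -> \det (edges pos d.+1 K) != 0 ->
  gram pos d (K :\ v)%SET =
  gram pos d.+1 K * Num.sqrt (dot (g v) (g v)).
Proof.
move=> vK K0; set F := (K :\ v)%SET; have Fd : #|F| = d.+1 by exact: facet_card.
pose E : 'M[R]_(d, d.+1) := edges pos d F.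
pose e : 'rV[R]_d.+1 := pos v - svertex pos F 0.
pose A : 'M[R]_(1 + d) := col_mx e E.
pose N : 'M[R]_(1 + d) := col_mx (g v) E.
have Ai : \matrix_(i < d.+1) (facet_order F v i.+1 - facet_order F v 0%N) = A.
  apply/row_matrixP => i; rewrite rowK.
  case: (split_ordP (i : 'I_(1 + d))) => j ->.
    by rewrite -[RHS]/(row (lshift d j) (col_mx e E)) rowKu (ord1 j) row_id.
  by rewrite -[RHS]/(row (rshift 1 j) (col_mx e E)) rowKd rowK.
have detA : \det A ^+ 2 = \det (edges pos d.+1 K) ^+ 2.
  by rewrite -(sqr_det_facet_order vK) det_augmented -/F Ai.
have svF i : (i <= d)%N -> exists2 u, u \in F & svertex pos F i = pos u.
  by apply: svertex_mem.
have lF u : u \in F -> lam v (pos u) = 0.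
  rewrite !inE => /andP[uv uK]; rewrite (lam_vertex bK)//.
  by rewrite eq_sym (negbTE uv).
have eg : dot e (g v) = 1.
  rewrite /e; have [u uF ->] := svF 0%N isT.
  by rewrite -(lamB bK) (lF u uF) (lam_vertex bK)// eqxx subr0.
have Eg : E *m (g v)^T = 0.
  apply/row_matrixP => i; rewrite row_mul rowK mulmx_trdot row0.
  have [u uF ->] := svF i.+1 (ltn_ord i); have [u' uF' ->] := svF 0%N isT.
  by rewrite -(lamB bK) !lF// subrr; apply/matrixP => a b; rewrite !mxE mul0rn.
have gE : g v *m E^T = 0 by rewrite -[LHS]trmxK trmx_mul trmxK Eg trmx0.
have AN : \det A * \det N = \det (E *m E^T).
  rewrite -(det_tr N) -det_mulmx /A /N tr_col_mx mul_col_row.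
  by rewrite Eg mulmx_trdot eg det_ublock det1 mul1r.
have NN : \det N ^+ 2 = dot (g v) (g v) * \det (E *m E^T).
  rewrite -sqr_det_gram /N tr_col_mx mul_col_row gE Eg mulmx_trdot.
  by rewrite det_ublock det_scalar expr1.
have g0 := grad_neq0 vK.
have A0 : \det A != 0 by rewrite -sqrf_eq0 detA sqrf_eq0.
have N0 : \det N != 0.
  apply/det0P => -[c c0]; rewrite -[c]hsubmxK mul_row_col => cN.
  have c1 : lsubmx c = 0.
    have /(congr1 (mulmx^~ (g v)^T)) := cN.
    rewrite mulmxDl -!mulmxA Eg mulmx0 addr0 mul0mx mulmx_trdot.
    rewrite mul_mx_scalar => /eqP; rewrite scaler_eq0 (gt_eqF g0)/=.
    by move/eqP.
  have A' : c *m A = 0.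
    rewrite -[c]hsubmxK mul_row_col c1 mul0mx add0r.
    by move: cN; rewrite c1 mul0mx add0r.
  by move/det0P: A0; apply; exists c.
have NA : \det N = dot (g v) (g v) * \det A.
  by apply: (mulfI N0); rewrite -expr2 NN -AN; ring.
rewrite gram_cell /gram -/E -AN NA.
have -> : \det A * (dot (g v) (g v) * \det A) = \det (edges pos d.+1 K) ^+ 2 * dot (g v) (g v).
  by rewrite -detA; ring.
by rewrite sqrtrM ?sqr_ge0// sqrtr_sqr.
Qed.

(** The facet normal weighted by facet measure is proportional to the gradient of the opposite
    coordinate, with a factor common to all facets of the cell; all square roots disappear. *)
Lemma gram_outward_normal v n y : v \in K -> \det (edges pos d.+1 K) != 0 ->
  is_outward_normal K (K :\ v)%SET n ->
  gram pos d (K :\ v)%SET * dot y n = - gram pos d.+1 K * dot y (g v).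
Proof.
move=> vK K0 /(outward_normalE vK)[c [c0 cg nE]]; rewrite gram_facet// nE.
suff -> : Num.sqrt (dot (g v) (g v)) = c^-1.
  by field; exact: lt0r_neq0.
have cn0 : c != 0 by exact: lt0r_neq0.
have -> : dot (g v) (g v) = c^-1 ^+ 2.
  by apply: (mulfI (expf_neq0 2 cn0)); rewrite cg; field.
by rewrite sqrtr_sqr ger0_norm// invr_ge0 ltW.
Qed.

(* By linearity it suffices to treat barycentric monomials, where both sides are
   given by the Dirichlet formula and agree because [\sum_v grad lam_v = 0]. *)
Lemma divergence_simplex (n : V -> point) (f : point -> R) y :
  \det (edges pos d.+1 K) != 0 -> polyfun f ->
  (forall v, v \in K -> is_outward_normal K (K :\ v)%SET (n v)) ->
  simplex_int pos d.+1 K (fun x => 'D_y f x) =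
  \sum_(v in K) dot y (n v) * simplex_int pos d (K :\ v)%SET f.
Proof.
move=> K0 + nP; move/(polyfun_bary_span bK).
elim=> [|{}f c a /(bary_span_polyfun bK) fp IH].
  under [in LHS]eq_fun do rewrite derive_cst; rewrite simplex_int0 big1// => v _.
  by rewrite simplex_int0 mulr0.
have mp := polyfun_bary_monomial bK.
have dp h : polyfun h -> forall x, derivable h x y.
  by move=> hp x; exact: polyfun_derivable.
have -> : (fun x => 'D_y (fun z => c * bary_monomial (K := K) (lam := lam) a z + f z) x) =
    (fun x => c * 'D_y (bary_monomial (K := K) (lam := lam) a) x + 'D_y f x).
  apply/funext => x.
  rewrite deriveD; [|exact: dp (polyfunM (polyfun_cst c) (mp a)) x|exact: dp].
  by rewrite (@deriveZ _ _ _ (bary_monomial a))//; exact: dp.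
rewrite simplex_intD; last 2 first.
- apply: simplex_integrableZ; apply: polyfun_integrable.
  exact: polyfun_derive.
- by apply: polyfun_integrable; exact: polyfun_derive.
rewrite simplex_intZ; last by apply: polyfun_integrable; exact: polyfun_derive.
rewrite IH; under [RHS]eq_bigr.
  move=> v _; rewrite simplex_intD; last 2 first.
  - by apply: simplex_integrableZ; exact: polyfun_integrable.
  - exact: polyfun_integrable.
  rewrite simplex_intZ; last exact: polyfun_integrable.
  rewrite mulrDr mulrCA; over.
rewrite big_split/= -mulr_sumr; congr (_ * _ + _) => {IH fp f c}.
(* The same quotient arises on both sides: in dimension [d.+1] after one exponent has been lowered,
   and in dimension [d] on the facet opposite to a vertex with exponent 0. *)
pose A : R := (\prod_(v in K) (a v)`!)%:R / (d + \sum_(v in K) a v)`!%:R.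
transitivity (\sum_(v in K) (if a v == 0%N then 0 else
   dot y (g v) * (gram pos d.+1 K * A))).
  have -> : (fun x => 'D_y (bary_monomial (K := K) (lam := lam) a) x) = (fun x =>
      \sum_(v in K) dot y (g v) * (a v)%:R *
        bary_monomial (K := K) (lam := lam) (fun w => a w - (w == v))%N x).
    by apply/funext => x; exact: (derive_bary_monomial bK).
  rewrite simplex_int_sum; last first.
    by move=> v _; apply: simplex_integrableZ; exact: polyfun_integrable.
  apply: eq_bigr => v vK; rewrite simplex_intZ; last exact: polyfun_integrable.
  rewrite (simplex_int_bary_monomial bK)//.
  have [->|av] := eqVneq (a v) 0%N; first by rewrite mulr0 mul0r.
  rewrite -!mulrA; congr (_ * _); rewrite mulrCA; congr (_ * _); rewrite /A.
  have -> : (d.+1 + \sum_(w in K) (a w - (w == v)) = d + \sum_(w in K) a w)%N.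
    rewrite (bigD1 v)//= [in RHS](bigD1 v)//= eqxx.
    rewrite -[in RHS](prednK (n := a v)) ?lt0n// subn1 !addSn !addnS.
    congr (_ + (_ + _)).+1; apply: eq_bigr => w /andP[_ /negbTE ->].
    by rewrite subn0.
  rewrite mulrA -natrM; congr (_%:R / _).
  rewrite (bigD1 v)//= [in RHS](bigD1 v)//= eqxx.
  rewrite -[in RHS](prednK (n := a v)) ?lt0n// factS prednK ?lt0n// subn1 mulnA.
  by congr (_ * _)%N; apply: eq_bigr => w /andP[_ /negbTE ->]; rewrite subn0.
(* The gradients sum to 0, so the sum over vertices of positive exponent is minus the sum over those
   of exponent 0, the only ones whose opposite facet contributes. *)
transitivity (\sum_(v in K) (if a v == 0%N then
   - (dot y (g v) * (gram pos d.+1 K * A)) else 0)).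
  apply/eqP; rewrite -subr_eq0 -sumrB; apply/eqP.
  transitivity (\sum_(v in K) dot y (g v) * (gram pos d.+1 K * A)).
    by apply: eq_bigr => v _; case: ifP; rewrite ?sub0r ?opprK ?subr0.
  by rewrite -mulr_suml (sum_dot_grad bK) mul0r.
apply: eq_bigr => v vK; have Fd : #|K :\ v|%SET = d.+1 by exact: facet_card.
have FK : (K :\ v)%SET \subset K by exact: subD1set.
have KF (T : Type) (idx : T) (op : Monoid.com_law idx) (F : V -> T) :
    \big[op/idx]_(w in K) F w = op (F v) (\big[op/idx]_(w in K :\ v) F w).
  by rewrite (big_setD1 v).
case: ifPn => av.
  rewrite [X in _ = _ * X](_ : _ = simplex_int pos d (K :\ v)%SET
      (fun x => \prod_(w in K :\ v) lam w x ^+ a w)); last first.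
    congr (simplex_int _ _ _ _); apply/funext => x; rewrite /bary_monomial KF /= (eqP av).
    by rewrite expr0 mul1r.
  rewrite (simplex_int_bary_monomial bK)// [in RHS]mulrCA [in RHS]mulrA.
  rewrite gram_outward_normal//; last exact: nP.
  rewrite /A !KF /= (eqP av) fact0 mul1n add0n.
  by rewrite -[in RHS]mulrA mulNr mulrCA.
(* A positive power of [lam v] vanishes on the facet opposite to [v]. *)
rewrite (eq_simplex_int (g := fun=> 0) Fd) ?simplex_int0 ?mulr0// => x xF.
rewrite /bary_monomial KF /= (lam_hull_notin bK _ FK _ xF)// ?inE ?eqxx//.
by rewrite expr0n (negbTE av) mul0r.
Qed.

End FacetGeometry.

(** * Integrals over the mesh *)

Section MeshIntegrals.
Context {R : realType} {d : nat} (M : mesh R d.+1).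
Notation point := 'rV[R]_d.+1.
Notation V := (mvertex M).
Notation pos := (@mpos R d.+1 M).
Notation cells := (cells M).
Implicit Types (K F : {set V}).

Lemma cell_barycentric K : K \in cells ->
  exists lam g, barycentric pos K lam g.
Proof.
by move=> KM; apply: barycentric_exists; [exact: mesh_card|exact: mesh_nondegenerate].
Qed.

Lemma cell_det_neq0 K : K \in cells -> \det (edges pos d.+1 K) != 0.
Proof.
by move=> KM; apply: det_edges_neq0; [exact: mesh_card|exact: mesh_nondegenerate].
Qed.

Lemma outward_normalP K v : K \in cells -> v \in K ->
  is_outward_normal pos K (K :\ v)%SET (outward_normal K (K :\ v)%SET).
Proof.
move=> KM vK; have [lam [g bK]] := cell_barycentric KM.
have [n nP] := exists_outward_normal (mesh_card KM) bK vK.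
exact: (@xgetPex _ 0 [set n | is_outward_normal pos K (K :\ v)%SET n] (ex_intro _ n nP)).
Qed.

Lemma bdry_int_vertices K (G : {set V} -> point -> point -> R) : K \in cells ->
  bdry_int K G =
  \sum_(v in K) facet_int (K :\ v)%SET (G (K :\ v)%SET (outward_normal K (K :\ v)%SET)).
Proof.
move=> KM; have Kd := mesh_card KM.
rewrite /bdry_int -(@big_imset _ _ _ _ _ (fun v => K :\ v)%SET _
  (fun F => facet_int F (G F (outward_normal K F)))); last first.
  move=> v w vK wK /setP/(_ v); rewrite !inE eqxx vK/= andbT.
  by move=> /esym/negbFE/eqP.
apply: eq_bigl => F; apply/andP/imsetP.
  move=> [FK /eqP Fd]; have : (0 < #|K :\: F|)%N.
    by rewrite cardsDS// Kd Fd subSnn.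
  move=> /card_gt0P[v]; rewrite inE => /andP[vF vK]; exists v => //.
  apply/eqP; rewrite eqEcard subsetD1 FK vF/= Fd.
  by rewrite (facet_card Kd vK).
by move=> [v vK ->]; rewrite subD1set (facet_card Kd vK).
Qed.

Definition vpoly (u : point -> point) := forall i, polyfun (fun x => u x 0 i).

Lemma polyfun_dot u n : vpoly u -> polyfun (fun x => dot (u x) n).
Proof.
move=> up; apply: polyfun_sum => i _; apply: polyfunM => //; exact: polyfun_cst.
Qed.

Lemma polyfun_diverg u : vpoly u -> polyfun (diverg u).
Proof.
move=> up; rewrite (_ : diverg u = (fun x => \sum_i 'D_(delta_mx 0 i) (fun y => u y 0 i) x)).
  by apply: polyfun_sum => i _; exact: polyfun_derive.
by apply/funext => x; apply: eq_bigr => i _; rewrite mxE.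
Qed.

Lemma polyfun_dot_grad u f : vpoly u -> polyfun f ->
  polyfun (fun x => dot (u x) (grad f x)).
Proof.
move=> up fp; apply: polyfun_sum => i _; apply: polyfunM => //.
rewrite (_ : (fun x => _) = (fun x => 'D_(delta_mx 0 i) f x)).
  exact: polyfun_derive.
by apply/funext => x; rewrite mxE.
Qed.

Lemma divergence_cell K u : K \in cells -> vpoly u ->
  cell_int K (diverg u) = bdry_int K (fun _ n x => dot (u x) n).
Proof.
move=> KM up; have [lam [g bK]] := cell_barycentric KM.
rewrite bdry_int_vertices// /cell_int.
rewrite (_ : diverg u = (fun x => \sum_i 'D_(delta_mx 0 i) (fun y => u y 0 i) x)); last first.
  by apply/funext => x; apply: eq_bigr => i _; rewrite mxE.
rewrite simplex_int_sum; last first.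
  by move=> i _; apply: polyfun_integrable; exact: polyfun_derive.
under eq_bigr => i _ do rewrite (divergence_simplex (mesh_card KM) bK _
  (cell_det_neq0 KM) (up i) (fun v => outward_normalP KM (v := v))).
rewrite exchange_big/=; apply: eq_bigr => v vK.
rewrite /facet_int simplex_int_sum; last first.
  move=> i _; apply: polyfun_integrable; apply: polyfunM => //; exact: polyfun_cst.
apply: eq_bigr => i _; rewrite dot_delta.
rewrite -simplex_intZ; last exact: polyfun_integrable.
by congr (simplex_int _ _ _ _); apply/funext => x; rewrite mulrC.
Qed.

Lemma diverg_mul f u x : polyfun f -> vpoly u ->
  diverg (fun y => f y *: u y) x = f x * diverg u x + dot (u x) (grad f x).
Proof.
move=> fp up; rewrite /diverg /mxtrace /dot mulr_sumr -big_split/=.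
apply: eq_bigr => i _; rewrite !mxE.
rewrite (_ : (fun y => _) = f * (fun y => u y 0 i)); last first.
  by apply/funext => y; rewrite mxE.
by rewrite deriveM//; exact: polyfun_derivable.
Qed.

Lemma integration_by_parts K f u : K \in cells -> polyfun f -> vpoly u ->
  cell_int K (fun x => dot (u x) (grad f x)) =
  bdry_int K (fun _ n x => f x * dot (u x) n) - cell_int K (fun x => f x * diverg u x).
Proof.
move=> KM fp up; have fup : vpoly (fun y => f y *: u y).
  move=> i; under eq_fun do rewrite mxE; exact: polyfunM.
have := divergence_cell KM fup.
have -> : bdry_int K (fun _ n x => dot (f x *: u x) n) =
    bdry_int K (fun _ n x => f x * dot (u x) n).
  by congr (bdry_int _ _); apply/funext => F; apply/funext => n; apply/funext => x; rewrite dotZl.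
move=> <-; rewrite /cell_int.
rewrite (_ : diverg (fun y => f y *: u y) = (fun x => f x * diverg u x + dot (u x) (grad f x))).
  rewrite simplex_intD; [by rewrite addrAC subrr add0r| |]; apply: polyfun_integrable.
    by apply: polyfunM => //; exact: polyfun_diverg.
  exact: polyfun_dot_grad.
by apply/funext => x; exact: diverg_mul.
Qed.

Lemma sum_cells (F : {set V} -> R) :
  \sum_(K in cells) F K = \sum_(K in mesh_s M) F K + \sum_(K in mesh_d M) F K.
Proof.
rewrite (bigID (mem (mesh_s M)))/=; congr (_ + _); apply: eq_bigl => K; rewrite inE.
  by case: (K \in mesh_s M); rewrite ?andbF.
have := @mesh_disjoint _ _ M K.
by case: (K \in mesh_s M) => [/(_ isT)/negbTE ->|]; rewrite ?andbF ?andbT.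
Qed.

Lemma mesh_s_cells K : K \in mesh_s M -> K \in cells.
Proof. by rewrite inE => ->. Qed.

Lemma mesh_d_cells K : K \in mesh_d M -> K \in cells.
Proof. by rewrite inE orbC => ->. Qed.

Lemma cell_volume_gt0 K : K \in cells -> 0 < cell_int K (fun=> 1).
Proof.
move=> KM; have [lam [g bK]] := cell_barycentric KM.
have := simplex_int_bary_monomial bK (fun=> 0%N) (mesh_card KM) (fintype.subxx K).
rewrite /cell_int (_ : (fun x => _) = (fun=> 1)); last first.
  by apply/funext => x; rewrite big1.
move=> ->; rewrite gram_cell mulr_gt0 ?normr_gt0 ?cell_det_neq0//.
by rewrite divr_gt0// ltr0n ?fact_gt0// big1.
Qed.

Lemma cell_int0 K (f : point -> R) : (forall x, f x = 0) -> cell_int K f = 0.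
Proof.
by move=> f0; rewrite (_ : f = fun=> 0) ?/cell_int ?simplex_int0//; apply/funext.
Qed.

Lemma bdry_int0 K (G : {set V} -> point -> point -> R) :
  (forall F n x, G F n x = 0) -> bdry_int K G = 0.
Proof.
move=> G0; apply: big1 => F _; rewrite /facet_int.
rewrite (_ : G F (outward_normal K F) = fun=> 0) ?simplex_int0//.
by apply/funext => x.
Qed.

Lemma interface_int0 (G : {set V} -> point -> point -> R) :
  (forall F n x, G F n x = 0) -> @interface_int _ _ M G = 0.
Proof.
move=> G0; apply: big1 => K _; apply: big1 => F _; rewrite /facet_int.
rewrite (_ : G F (outward_normal K F) = fun=> 0) ?simplex_int0//.
by apply/funext => x.
Qed.

Lemma strain0 x : strain (fun=> 0 : point) x = 0.
Proof.
have j0 : jac (fun=> 0 : point) x = 0.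
  apply/matrixP => i j; rewrite mxE.
  rewrite (_ : (fun y : point => (0 : point) 0 i) = fun=> 0) ?derive_cst ?mxE//.
by rewrite /strain j0 trmx0 addr0 scaler0.
Qed.

Lemma diverg0 x : diverg (fun=> 0 : point) x = 0.
Proof.
rewrite /diverg /mxtrace big1// => i _; rewrite mxE.
rewrite (_ : (fun y : point => (0 : point) 0 i) = fun=> 0) ?derive_cst//.
by apply/funext => y; rewrite mxE.
Qed.

Lemma grad_cst c x : grad (fun _ : point => c) x = 0.
Proof. by apply/rowP => j; rewrite !mxE derive_cst. Qed.

Lemma mulv0r (A : 'M[R]_d.+1) : mulv A 0 = 0.
Proof. exact: mul0mx. Qed.

Lemma mulv0l (x : point) : mulv 0 x = 0.
Proof. by rewrite /mulv trmx0 mulmx0. Qed.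

Lemma frob0r (A : 'M[R]_d.+1) : frob A 0 = 0.
Proof. by rewrite /frob big1// => i _; rewrite big1// => j _; rewrite mxE mulr0. Qed.

Lemma frob0l (A : 'M[R]_d.+1) : frob 0 A = 0.
Proof. by rewrite /frob big1// => i _; rewrite big1// => j _; rewrite mxE mul0r. Qed.

End MeshIntegrals.

(** * The discrete scheme *)

Section Discretization.
Context {R : realType} {d : nat} (M : mesh R d.+1) (P : params R d.+1).
Notation point := 'rV[R]_d.+1.
Notation V := (mvertex M).
Notation pos := (@mpos R d.+1 M).
Notation cells := (cells M).
Implicit Types (K F : {set V}) (u : vbroken M) (w : broken M).

Definition poly_broken w := forall K, K \in cells -> polyfun (w K).

Lemma in_broken_poly m w : in_broken m w -> poly_broken w.
Proof. by move=> wm K /wm; exact: is_poly_polyfun. Qed.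

Lemma in_Vh_vpoly k u K : in_Vh k u -> K \in cells -> vpoly (u K).
Proof. by move=> uk KM i; apply: is_poly_polyfun (uk K KM i). Qed.

Lemma is_poly_diverg k u K : in_Vh k u -> K \in cells ->
  is_poly k.-1 (diverg (u K)).
Proof.
move=> uk KM.
rewrite (_ : diverg _ = (fun x => \sum_i 'D_(delta_mx 0 i) (fun y => u K y 0 i) x)).
  by apply: is_poly_sum => i _; apply: is_poly_derive; exact: uk.
by apply/funext => x; apply: eq_bigr => i _; rewrite mxE.
Qed.

(** Each element contributes with its own outward normal. On a facet between two elements this is
    the jump of the normal component, on a boundary facet its trace, so that [jump u = 0] also
    contains the condition of no flux through the boundary. *)
Definition jump u F (x : point) : R :=
  \sum_(K in cells | facet_of K F) dot (u K x) (outward_normal K F).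

Lemma is_poly_jump k u F : in_Vh k u -> is_poly k (jump u F).
Proof.
move=> uk; apply: is_poly_sum => K /andP[KM _]; apply: is_poly_sum => i _.
under eq_fun do rewrite mulrC; apply: is_polyZ; exact: uk.
Qed.

Lemma sum_bdry_int_flux k u (h : broken M) : in_Vh k u ->
  (forall F, is_facet cells F -> simplex_bounded pos d F (h F)) ->
  \sum_(K in cells) bdry_int K (fun F n x => h F x * dot (u K x) n) =
  \sum_(F | is_facet cells F) facet_int F (fun x => jump u F x * h F x).
Proof.
move=> uk hb; rewrite /bdry_int.
rewrite (exchange_big_dep (is_facet cells))/=; last first.
  by move=> K F KM KF; apply/existsP; exists K; rewrite KM.
apply: eq_bigr => F Fcells; rewrite /facet_int -simplex_int_sum.
  by congr (simplex_int _ _ _ _); apply/funext => x; rewrite -mulr_sumr mulrC.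
move=> K /andP[KM _]; apply: simplex_bounded_integrable.
apply: simplex_boundedM; first exact: hb.
by apply: polyfun_bounded; apply: polyfun_dot; exact: (in_Vh_vpoly uk KM).
Qed.

Lemma facet_poly_bounded l F f : #|F| = d.+1 -> facet_poly l F f ->
  simplex_bounded pos d F f.
Proof.
move=> Fd [q qp fq].
have [mq [B qB]] := polyfun_bounded (pos := pos) (m := d) (S := F) (is_poly_polyfun qp).
have E t : @ref_simplex R d t -> f (param pos F t) = q (param pos F t).
  by move=> ts; apply: fq; exact: param_hull.
split; last by exists B => t ts; rewrite E// qB.
by apply: eq_measurable_fun mq => t; rewrite inE => /E.
Qed.

Lemma is_facet_card F : is_facet cells F -> #|F| = d.+1.
Proof. by case/existsP => K /and3P[_ _ /eqP]. Qed.

(** What the transport scheme sees of the flow. Fluxes are tested with arbitrary bounded facet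
    functions, not only with polynomials of degree [k], because [wb] has degree [l]. *)
Definition mass_conservative k (fd : point -> R) u : Prop :=
  [/\ in_Vh k u,
      forall q : broken M, in_Qh k q ->
        \sum_(K in cells) cell_int K (fun x => q K x * diverg (u K) x) =
        - \sum_(K in mesh_d M) cell_int K (fun x => fd x * q K x)
    & forall h : broken M, (forall F, is_facet cells F -> simplex_bounded pos d F (h F)) ->
        \sum_(K in cells) bdry_int K (fun F n x => h F x * dot (u K x) n) = 0].

Lemma is_facet_sub (T : {set {set V}}) F : {subset T <= cells} -> is_facet T F ->
  is_facet cells F.
Proof.
move=> Tc /existsP[K /andP[KT KF]]; apply/existsP; exists K.
by rewrite Tc.
Qed.

Lemma bh_zero_velocity (p1 p2 p3 : broken M) :
  bh p1 p2 p3 (fun _ _ => 0) (fun=> 0) = 0.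
Proof.
rewrite /bh interface_int0 ?subr0; last by move=> F n x; rewrite dot0l mulr0.
rewrite !big1 ?addr0 ?oppr0// => K _; try (apply: bdry_int0 => F n x).
- by rewrite dot0l mulr0.
- by rewrite dot0l mulr0.
- by apply: cell_int0 => x; rewrite diverg0 mulr0.
Qed.

(* Taking the same facet multiplier on both sides of the interface cancels the
   interface term; the choice of the jump of the normal flux itself, a polynomial
   of degree [k] on each facet, then forces that jump to vanish. *)
Lemma velocity_solutionP k fs fd u : velocity_solution P k fs fd u ->
  mass_conservative k fd u.
Proof.
case=> ub [p [ps [pd [[uk _ _ _ _] flow]]]].
have {}flow (q qb : broken M) : in_Qh k q -> (forall F, is_facet cells F -> is_poly k (qb F)) ->
    - \sum_(K in cells) cell_int K (fun x => q K x * diverg (u K) x) +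
      \sum_(K in cells) bdry_int K (fun F n x => qb F x * dot (u K x) n) =
    \sum_(K in mesh_d M) cell_int K (fun x => fd x * q K x).
  move=> qQ qbP.
  have qbar (T : {set {set V}}) : {subset T <= cells} -> in_Qbar k T qb.
    by move=> Tc F /(is_facet_sub Tc) /qbP qbF; exists (qb F).
  have v0 : in_Vh k (fun (_ : {set V}) (_ : point) => 0 : point).
    move=> K _ i; rewrite (_ : (fun _ => _) = (fun=> 0)); first exact: is_poly0.
    by apply/funext => x; rewrite mxE.
  have vb0 : in_Vbar M k (fun=> 0 : point).
    split => //.
      move=> F _ i; exists (fun=> 0); first exact: is_poly0.
      by move=> x _; rewrite mxE.
    by apply: continuous_subspaceT => x; exact: cst_continuous.
  have := flow (fun _ _ => 0) (fun=> 0) q qb qb v0 vb0 qQ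
    (qbar _ (@mesh_s_cells _ _ M)) (qbar _ (@mesh_d_cells _ _ M)).
  have -> : ah P u ub (fun _ _ => 0) (fun=> 0) = 0.
    rewrite /ah interface_int0 ?addr0; last first.
      by move=> F n x; rewrite /tangential dot0l scale0r subr0 dot0r mulr0.
    rewrite big1 ?add0r; last first.
      move=> K _; rewrite cell_int0; last first.
        by move=> x; rewrite strain0 frob0r mulr0.
      rewrite !bdry_int0 ?subr0 ?addr0// => F n x.
      - by rewrite strain0 mulv0l scaler0 dot0l.
      - by rewrite ?subrr ?oppr0 dot0r.
      - by rewrite ?subrr ?oppr0 dot0r mulr0.
    by rewrite big1// => K _; apply: cell_int0 => x; rewrite dot0r mulr0.
  rewrite bh_zero_velocity !add0r [X in _ = X + _]big1 ?add0r; last first.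
    by move=> K _; apply: cell_int0 => x; rewrite dot0r.
  move=> <-; rewrite /bh interface_int0 ?subr0; last first.
    by move=> F n x; rewrite subrr mul0r.
  by rewrite -sum_cells.
have Q0 : in_Qh k (fun (_ : {set V}) (_ : point) => 0 : R).
  split; first by move=> K _; exact: is_poly0.
  by rewrite big1// => K _; exact: cell_int0.
have J0 F : is_facet cells F -> facet_int F (fun x => jump u F x ^+ 2) = 0.
  move: F; apply: psumr_eq0P.
    by move=> F _; apply: simplex_int_ge0 => x; exact: sqr_ge0.
  have := flow _ (jump u) Q0 (fun F _ => is_poly_jump F uk).
  rewrite [X in - X + _]big1 ?oppr0 ?add0r; last first.
    by move=> K _; apply: cell_int0 => x; rewrite mul0r.
  rewrite [RHS]big1; last by move=> K _; apply: cell_int0 => x; rewrite mulr0.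
  rewrite (sum_bdry_int_flux uk); last first.
    by move=> F _; exact: (polyfun_bounded (is_poly_polyfun (is_poly_jump F uk))).
  move=> E; rewrite -[RHS]E; apply: eq_bigr => F _.
  by congr (simplex_int _ _ _ _); apply/funext => x; rewrite expr2.
(* The jump has zero L^2 norm on each facet, hence zero integral against any bounded function. *)
have H (h : broken M) : (forall F, is_facet cells F -> simplex_bounded pos d F (h F)) ->
    \sum_(K in cells) bdry_int K (fun F n x => h F x * dot (u K x) n) = 0.
  move=> hb; rewrite (sum_bdry_int_flux uk)// big1// => F Fc.
  apply: simplex_int_sqr_eq0; [|exact: hb|exact: J0].
  apply: simplex_bounded_L2; apply: polyfun_bounded.
  exact: (is_poly_polyfun (is_poly_jump F uk)).
split=> // q qQ; have := flow q (fun _ _ => 0) qQ (fun F _ => is_poly0 k).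
rewrite H => [|F _]; last exact: simplex_bounded_cst.
by rewrite addr0 => <-; rewrite opprK.
Qed.

(** Constants are not in [Q_h], so this comes from the flux condition with the facet function 1 and
    not from the divergence equation. *)
Lemma sum_diverg k fd u : mass_conservative k fd u ->
  \sum_(K in cells) cell_int K (diverg (u K)) = 0.
Proof.
move=> [uk _ H]; have := H (fun _ _ => 1) (fun F _ => simplex_bounded_cst _ _ _ _).
move=> E; rewrite -[RHS]E; apply: eq_bigr => K KM.
rewrite divergence_cell//; last exact: (in_Vh_vpoly uk KM).
congr (bdry_int _ _); apply/funext => F; apply/funext => n; apply/funext => x.
by rewrite mul1r.
Qed.

Lemma Bh_constant k l fd u a w wb : mass_conservative k fd u ->
  in_Ch l w -> in_Cbar M l wb ->
  Bh P u (cst_cell a) (cst_facet a) w wb =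
  a * \sum_(K in cells) cell_int K (fun x => w K x * diverg (u K) x).
Proof.
move=> [uk _ H] wl [wbl _].
have -> : Bh P u (cst_cell a) (cst_facet a) w wb =
    Ba u (cst_cell a) (cst_facet a) w wb.
  rewrite /Bh [X in _ + X]big1 ?addr0// => K KM.
  rewrite /cst_cell cell_int0; last by move=> x; rewrite grad_cst mulv0r dot0l.
  rewrite bdry_int0; last by move=> F n x; rewrite grad_cst mulv0r dot0l mul0r.
  rewrite bdry_int0; last by move=> F n x; rewrite subrr scale0r dot0l.
  rewrite bdry_int0; last by move=> F n x; rewrite subrr mulr0.
  by rewrite mulr0 !subr0 addr0.
have wbb F : is_facet cells F -> simplex_bounded pos d F wb.
  by move=> Fc; apply: facet_poly_bounded (wbl F Fc); exact: is_facet_card.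
have H' := H (fun F => wb) wbb.
(* The flux term with [wb] can be inserted freely: [wb] is single-valued on facets, so its sum over
   all elements vanishes. *)
transitivity (a * (\sum_(K in cells) cell_int K (fun x => w K x * diverg (u K) x) -
   \sum_(K in cells) bdry_int K (fun F n x => wb x * dot (u K x) n))); last first.
  by rewrite H' subr0.
rewrite -sumrB mulr_sumr; apply: eq_bigr => K KM.
have wp : polyfun (w K) by exact: (is_poly_polyfun (wl K KM)).
have up := in_Vh_vpoly uk KM.
rewrite [X in _ - X]bdry_int0 ?subr0; last first.
  by move=> F n x; case: ifP => // _; rewrite subrr mulr0 mul0r.
have -> : cell_int K (fun x => cst_cell a K x * dot (u K x) (grad (w K) x)) =
    a * cell_int K (fun x => dot (u K x) (grad (w K) x)).
  by apply: simplex_intZ; apply: polyfun_integrable; exact: polyfun_dot_grad.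
rewrite integration_by_parts// mulrBr opprB.
have -> : bdry_int K (fun _ n x => cst_cell a K x * dot (u K x) n * (w K x - wb x)) =
   a * (bdry_int K (fun _ n x => w K x * dot (u K x) n) -
        bdry_int K (fun _ n x => wb x * dot (u K x) n)).
  rewrite -sumrB mulr_sumr; apply: eq_bigr => F KF.
  have Fc : is_facet cells F by apply/existsP; exists K; rewrite KM.
  have ib f : simplex_bounded pos d F f ->
      simplex_integrable pos d F (fun x => f x * dot (u K x) (outward_normal K F)).
    move=> fb; apply: simplex_bounded_integrable; apply: simplex_boundedM => //.
    by apply: polyfun_bounded; exact: polyfun_dot.
  have i1 := ib _ (polyfun_bounded (pos := pos) (m := d) (S := F) wp).
  have i2 := ib _ (wbb F Fc).
  rewrite /facet_int -simplex_intB// -simplex_intZ; last exact: simplex_integrableB.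
  by congr (simplex_int _ _ _ _); apply/funext => x; rewrite /cst_cell; ring.
by ring.
Qed.

(** By [Bh_constant], [a * defect u fd w] is the residual of the constant [(a, a)] in the scheme
    tested with [w]. *)
Definition defect u (fd : point -> R) w : R :=
  \sum_(K in cells) cell_int K (fun x => w K x * diverg (u K) x) +
  \sum_(K in mesh_d M) cell_int K (fun x => fd x * w K x).

Lemma in_Cbar0 l : in_Cbar M l (fun=> 0).
Proof.
split; last by apply: continuous_subspaceT => x; exact: cst_continuous.
by move=> F _; exists (fun=> 0) => //; exact: is_poly0.
Qed.

Lemma L2_poly_integrable (T : {set {set V}}) fd K f : L2_on T fd -> K \in T ->
  polyfun f -> simplex_integrable pos d.+1 K (fun x => fd x * f x).
Proof.
by move=> f2 KT fp; apply: simplex_L2_integrableM; [exact: f2|exact: polyfun_bounded].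
Qed.

Lemma preserves_constantE k l fd u a : L2_on (mesh_d M) fd ->
  mass_conservative k fd u ->
  preserves_constant P l u fd a <->
  forall w, in_Ch l w -> a * defect u fd w = 0.
Proof.
move=> f2 sol.
have E w : in_Ch l w -> \sum_(K in mesh_d M) cell_int K (fun x => fd x * a * w K x) =
    a * \sum_(K in mesh_d M) cell_int K (fun x => fd x * w K x).
  move=> wl; rewrite mulr_sumr; apply: eq_bigr => K KM.
  rewrite -[RHS]simplex_intZ; last first.
    apply: (L2_poly_integrable f2 KM).
    exact: (in_broken_poly wl (mesh_d_cells KM)).
  by congr (simplex_int _ _ _ _); apply/funext => x; rewrite mulrA (mulrC a).
split=> [pr w wl|df w wb wl wbl].
  have := pr w _ wl (in_Cbar0 l); rewrite (Bh_constant _ sol wl (in_Cbar0 l)).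
  by rewrite E// /defect mulrDr => ->; rewrite addNr.
rewrite (Bh_constant _ sol wl wbl) E//; apply/eqP; rewrite -addr_eq0 -mulrDr.
by apply/eqP; exact: df.
Qed.

Lemma defectD u fd w w' k : in_Vh k u -> L2_on (mesh_d M) fd ->
  poly_broken w -> poly_broken w' ->
  defect u fd (fun K x => w K x + w' K x) = defect u fd w + defect u fd w'.
Proof.
move=> uk f2 wp wp'; rewrite /defect addrACA -!big_split/=; congr (_ + _).
  apply: eq_bigr => K KM; rewrite -simplex_intD; last 2 first.
  - apply: polyfun_integrable; apply: polyfunM; first exact: wp.
    exact: (polyfun_diverg (in_Vh_vpoly uk KM)).
  - apply: polyfun_integrable; apply: polyfunM; first exact: wp'.
    exact: (polyfun_diverg (in_Vh_vpoly uk KM)).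
  by congr (simplex_int _ _ _ _); apply/funext => x; rewrite mulrDl.
apply: eq_bigr => K KM; have Kc := mesh_d_cells KM; rewrite -simplex_intD; last 2 first.
- exact: (L2_poly_integrable f2 KM (wp K Kc)).
- exact: (L2_poly_integrable f2 KM (wp' K Kc)).
by congr (simplex_int _ _ _ _); apply/funext => x; rewrite mulrDr.
Qed.

Lemma defect_Qh k fd u (q : broken M) : mass_conservative k fd u -> in_Qh k q ->
  defect u fd q = 0.
Proof. by move=> [_ H _] /H; rewrite /defect => ->; rewrite addNr. Qed.

(** Complements [defect_Qh], which says nothing about constants; the zero mean of [fd] enters
    here. *)
Lemma defect_cst k fd u c : mass_conservative k fd u ->
  L2_on (mesh_d M) fd -> \sum_(K in mesh_d M) cell_int K fd = 0 ->
  defect u fd (fun _ _ => c) = 0.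
Proof.
move=> sol f2 f0; rewrite /defect.
transitivity (c * \sum_(K in cells) cell_int K (diverg (u K)) +
              c * \sum_(K in mesh_d M) cell_int K fd); last first.
  by rewrite f0 (sum_diverg sol) !mulr0 addr0.
rewrite !mulr_sumr; congr (_ + _); apply: eq_bigr => K KM.
  rewrite -simplex_intZ//; apply: polyfun_integrable; apply: polyfun_diverg.
  by case: sol => uk _ _; exact: (in_Vh_vpoly uk KM).
rewrite -simplex_intZ; first by congr (simplex_int _ _ _ _); apply/funext => x; rewrite mulrC.
by apply: simplex_L2_integrable; exact: f2.
Qed.

Lemma volume_gt0 (T : {set {set V}}) : {subset T <= cells} -> (0 < #|T|)%N ->
  0 < \sum_(K in T) cell_int K (fun=> 1 : R).
Proof.
move=> Tc /card_gt0P[K KT].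
rewrite (bigD1 K)//= ltr_pwDl ?cell_volume_gt0 ?Tc// sumr_ge0// => L _.
by apply: simplex_int_ge0.
Qed.

Lemma defect_eq0_low k l fd u w : mass_conservative k fd u ->
  L2_on (mesh_d M) fd -> \sum_(K in mesh_d M) cell_int K fd = 0 ->
  (l <= k.-1)%N -> in_Ch l w -> defect u fd w = 0.
Proof.
move=> sol f2 f0 lk wl; have wp := in_broken_poly wl.
(* The mean of [w] over the domain: [w - c] lies in [Q_h] when [l <= k.-1], and the constant [c] is
   treated separately. *)
pose c := (\sum_(K in cells) cell_int K (w K)) / \sum_(K in cells) cell_int K (fun=> 1 : R).
have -> : w = (fun K x => (w K x + - c) + c).
  by apply/funext => K; apply/funext => x; rewrite subrK.
have cp b : poly_broken (fun (_ : {set V}) (_ : point) => b) by move=> K _; exact: polyfun_cst.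
have [uk _ _] := sol.
rewrite (defectD uk f2); last exact: cp; last first.
  by move=> K KM; apply: polyfunD; [exact: wp|exact: polyfun_cst].
rewrite (defect_cst _ sol)// addr0; apply: (defect_Qh sol); split.
  move=> K KM; apply: is_polyD; last exact: is_poly_cst.
  by apply: (is_polyW lk); exact: wl.
transitivity (\sum_(K in cells) cell_int K (w K) - c * \sum_(K in cells) cell_int K (fun=> 1)).
  rewrite mulr_sumr -sumrB; apply: eq_bigr => K KM.
  rewrite /cell_int simplex_intB; last 2 first.
  - exact: (polyfun_integrable (wp K KM)).
  - exact: (polyfun_integrable (polyfun_cst _)).
  congr (_ - _); rewrite -[RHS]simplex_intZ; last exact: (polyfun_integrable (polyfun_cst _)).
  by under [in RHS]eq_fun do rewrite mulr1.
rewrite /c divfK ?subrr// gt_eqF// volume_gt0//.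
by apply: leq_trans (mesh_d_nonempty M) _; apply/subset_leq_card/finset.subsetUr.
Qed.

Lemma sum_sqr_eq0 (T : {set {set V}}) (f : {set V} -> point -> R) K :
  \sum_(K in T) cell_int K (fun x => f K x ^+ 2) = 0 -> K \in T ->
  cell_int K (fun x => f K x ^+ 2) = 0.
Proof.
move=> /psumr_eq0P h KT; apply: h => // L _.
by apply: simplex_int_ge0 => x; exact: sqr_ge0.
Qed.

(** The divergence of [u] itself belongs to [Q_h]; testing with it shows that its L^2 norm is 0, and
    the defect then vanishes for polynomials [w] of any degree. *)
Lemma defect_eq0_nosource k fd u w : mass_conservative k fd u ->
  L2_on (mesh_d M) fd -> \sum_(K in mesh_d M) cell_int K (fun x => fd x ^+ 2) = 0 ->
  poly_broken w -> defect u fd w = 0.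
Proof.
move=> sol f2 ff0 wp; have [uk H _] := sol.
have fw w' : poly_broken w' ->
    \sum_(K in mesh_d M) cell_int K (fun x => fd x * w' K x) = 0.
  move=> wp'; apply: big1 => K KM; apply: simplex_int_sqr_eq0; first exact: f2.
    exact: (polyfun_bounded (wp' K (mesh_d_cells KM))).
  exact: (@sum_sqr_eq0 (mesh_d M) (fun=> fd) K ff0 KM).
have dp : poly_broken (fun K => diverg (u K)).
  by move=> K KM; apply: polyfun_diverg; exact: (in_Vh_vpoly uk KM).
have dQ : in_Qh k (fun K => diverg (u K)).
  split; last exact: (sum_diverg sol).
  by move=> K KM; exact: is_poly_diverg.
have := H _ dQ; rewrite fw// oppr0 => dd.
rewrite /defect fw// addr0 big1// => K KM.
under [X in cell_int _ X]eq_fun do rewrite mulrC.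
apply: simplex_int_sqr_eq0.
- exact: (simplex_bounded_L2 (polyfun_bounded (dp K KM))).
- exact: (polyfun_bounded (wp K KM)).
- exact: (@sum_sqr_eq0 cells (fun K => diverg (u K)) K dd KM).
Qed.

(** The function [div u + pf] lies in [Q_h] and is orthogonal to [Q_h], hence vanishes in L^2. The
    second sum runs over all cells because the zero-mean constraint can make [pf] nonzero on the
    Stokes region. *)
Lemma defect_PiQ k fd u (pf : broken M) w : mass_conservative k fd u ->
  L2_on (mesh_d M) fd -> is_PiQ k fd pf -> poly_broken w ->
  defect u fd w = \sum_(K in mesh_d M) cell_int K (fun x => fd x * w K x) -
                  \sum_(K in cells) cell_int K (fun x => pf K x * w K x).
Proof.
move=> sol f2 [[pfk pf0] pfP] wp; have [uk H _] := sol.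
have dp : poly_broken (fun K => diverg (u K)).
  by move=> K KM; apply: polyfun_diverg; exact: (in_Vh_vpoly uk KM).
have pp := in_broken_poly pfk.
pose e : broken M := fun K x => diverg (u K) x + pf K x.
have ep : poly_broken e.
  by move=> K KM; apply: polyfunD; [exact: dp|exact: pp].
have eQ : in_Qh k e.
  split.
    by move=> K KM; apply: is_polyD; [exact: is_poly_diverg|exact: pfk].
  transitivity (\sum_(K in cells) cell_int K (diverg (u K)) +
                \sum_(K in cells) cell_int K (pf K)); last first.
    by rewrite pf0 (sum_diverg sol) addr0.
  rewrite -big_split/=; apply: eq_bigr => K KM; rewrite -simplex_intD//.
    exact: (polyfun_integrable (dp K KM)).
  exact: (polyfun_integrable (pp K KM)).
have split_e w' : poly_broken w' ->
    \sum_(K in cells) cell_int K (fun x => e K x * w' K x) =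
    \sum_(K in cells) cell_int K (fun x => w' K x * diverg (u K) x) +
    \sum_(K in cells) cell_int K (fun x => pf K x * w' K x).
  move=> wp'; rewrite -big_split/=; apply: eq_bigr => K KM; rewrite -simplex_intD.
  - by congr (simplex_int _ _ _ _); apply/funext => x; rewrite /e mulrDl mulrC.
  - by apply: polyfun_integrable; apply: polyfunM; [exact: wp'|exact: dp].
  - by apply: polyfun_integrable; apply: polyfunM; [exact: pp|exact: wp'].
have ee : \sum_(K in cells) cell_int K (fun x => e K x ^+ 2) = 0.
  under eq_bigr => K _.
    rewrite (_ : (fun x => _) = (fun x => e K x * e K x)); last first.
      by apply/funext => x; rewrite expr2.
    over.
  by rewrite split_e// H// pfP// addNr.
have := split_e w wp; rewrite big1.
  by move=> E; rewrite /defect; apply/eqP; rewrite eq_sym subr_eq addrAC -E add0r.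
move=> K KM; apply: simplex_int_sqr_eq0.
- exact: (simplex_bounded_L2 (polyfun_bounded (ep K KM))).
- exact: (polyfun_bounded (wp K KM)).
- exact: (sum_sqr_eq0 ee KM).
Qed.

Lemma defect_projection_exact k l fd u (pf : broken M) : mass_conservative k fd u ->
  L2_on (mesh_d M) fd -> is_PiQ k fd pf ->
  (forall w, in_Ch l w -> defect u fd w = 0) <-> projection_exact l fd pf.
Proof.
move=> sol f2 pfQ; have pp := in_broken_poly pfQ.1.1; split=> [df w wl|ex w wl].
  (* Functions of [C_h] are discontinuous across facets, so cutting [w] off outside the Darcy region
     stays in [C_h]. *)
  pose w' : broken M := fun K => if K \in mesh_d M then w K else fun=> 0.
  have wl' : in_Ch l w'.
    by move=> K KM; rewrite /w'; case: ifP => _; [exact: wl|exact: is_poly0].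
  have := df _ wl'; rewrite (defect_PiQ sol f2 pfQ); last exact: (in_broken_poly wl').
  rewrite sum_cells [X in _ - (X + _)]big1 ?add0r; last first.
    move=> K KM; apply: cell_int0 => x.
    by rewrite /w' (negbTE (mesh_disjoint KM)) mulr0.
  move/eqP; rewrite subr_eq0 => /eqP E.
  transitivity (\sum_(K in mesh_d M) cell_int K (fun x => pf K x * w' K x)).
    by apply: eq_bigr => K KM; rewrite /w' KM.
  by rewrite -E; apply: eq_bigr => K KM; rewrite /w' KM.
(* Testing exactness with constants shows that [pf] vanishes on the Stokes
   region, even though the mean of [fd] is not assumed to be 0. *)
pose c := - (\sum_(K in mesh_s M) cell_int K (pf K)) /
  \sum_(K in mesh_d M) cell_int K (fun=> 1 : R).
pose q : broken M := fun K => if K \in mesh_d M then fun=> c else pf K.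
have cC : in_Ch l (fun (_ : {set V}) (_ : point) => c) by move=> K _; exact: is_poly_cst.
have qs K : K \in mesh_s M -> q K = pf K.
  by move=> KM; rewrite /q (negbTE (mesh_disjoint KM)).
have qd K : K \in mesh_d M -> q K = fun=> c by move=> KM; rewrite /q KM.
have qQ : in_Qh k q.
  split.
    move=> K KM; rewrite /q; case: ifP => _; first exact: is_poly_cst.
    exact: pfQ.1.1.
  rewrite sum_cells (eq_bigr (fun K => cell_int K (pf K))); last first.
    by move=> K KM; rewrite qs.
  rewrite [X in _ + X](eq_bigr (fun K => c * cell_int K (fun=> 1))); last first.
    move=> K KM; rewrite qd// -simplex_intZ; last exact: (polyfun_integrable (polyfun_cst _)).
    by congr (simplex_int _ _ _ _); apply/funext => x; rewrite mulr1.
  rewrite -mulr_sumr /c divfK ?subrr// gt_eqF// volume_gt0//.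
    exact: mesh_d_cells.
  exact: mesh_d_nonempty.
(* Exactness for the constant [c] cancels the Darcy contributions on the two sides and leaves the
   squared norm of [pf] over the Stokes region. *)
have := pfQ.2 q qQ; rewrite sum_cells.
rewrite [X in _ + X](eq_bigr (fun K => cell_int K (fun x => pf K x * c))); last first.
  by move=> K KM; rewrite qd.
rewrite (ex _ cC) [RHS](eq_bigr (fun K => cell_int K (fun x => fd x * c))); last first.
  by move=> K KM; rewrite qd.
move=> /(canRL (addrK _)); rewrite subrr => ps0.
have {}ps0 : \sum_(K in mesh_s M) cell_int K (fun x => pf K x ^+ 2) = 0.
  rewrite -[RHS]ps0; apply: eq_bigr => K KM; rewrite qs//.
rewrite (defect_PiQ sol f2 pfQ); last exact: (in_broken_poly wl).
rewrite sum_cells [X in _ - (X + _)]big1 ?add0r; last first.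
  move=> K KM; have Kc := mesh_s_cells KM; apply: simplex_int_sqr_eq0.
  - exact: (simplex_bounded_L2 (polyfun_bounded (pp K Kc))).
  - exact: (polyfun_bounded (in_broken_poly wl Kc)).
  - exact: (sum_sqr_eq0 ps0 KM).
by rewrite (ex w wl) subrr.
Qed.

End Discretization.

(** * Global conservation *)

Section RealFunctions.
Context {R : realType}.

Lemma is_derive_big_sum (W : normedModType R) (I : Type) (r : seq I) (Q : pred I)
    (F : I -> W -> R) (dF : I -> R) x v :
  (forall i, Q i -> is_derive x v (F i) (dF i)) ->
  is_derive x v (fun y => \sum_(i <- r | Q i) F i y) (\sum_(i <- r | Q i) dF i).
Proof.
move=> FdF; elim: r => [|i r IH].
  by under eq_fun do rewrite big_nil; rewrite big_nil; exact: is_derive_cst.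
rewrite big_cons; case Qi : (Q i); last by under eq_fun do rewrite big_cons Qi.
by under eq_fun do rewrite big_cons Qi; exact: (is_deriveD (FdF i Qi) IH).
Qed.

Lemma is_derive_scale (W : normedModType R) (F : W -> R) c x v df :
  is_derive x v F df -> is_derive x v (fun y => c * F y) (c * df).
Proof. by move=> Fdf; exact: (is_deriveZ c Fdf). Qed.

Lemma within_continuousP (A : set R) (f : R -> R) :
  {within A, continuous f} <->
  forall x, A x -> f y @[y --> within A (nbhs x)] --> f x.
Proof. exact: subspace_continuousP. Qed.

Lemma within_continuous_big_sum (A : set R) (I : Type) (r : seq I) (Q : pred I)
    (F : I -> R -> R) : (forall i, {within A, continuous (F i)}) ->
  {within A, continuous (fun y => \sum_(i <- r | Q i) F i y)}.
Proof.
move=> Fc; apply/within_continuousP => x Ax; elim: r => [|i r IH].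
  by under eq_fun do rewrite big_nil; rewrite big_nil; exact: cvg_cst.
rewrite big_cons; case Qi : (Q i); last by under eq_fun do rewrite big_cons Qi.
under eq_fun do rewrite big_cons Qi; apply: cvgD => //.
by have /within_continuousP := Fc i; exact.
Qed.

Lemma within_continuousZ (A : set R) (f : R -> R) c :
  {within A, continuous f} -> {within A, continuous (fun y => c * f y)}.
Proof.
move=> /within_continuousP fc; apply/within_continuousP => x Ax.
by apply: cvgM; [exact: cvg_cst|exact: fc].
Qed.

End RealFunctions.

Section Conservation.
Context {R : realType} {d : nat} (M : mesh R d.+1) (P : params R d.+1).
Notation point := 'rV[R]_d.+1.
Notation V := (mvertex M).
Notation cells := (cells M).

(** Every term of [Bh] contains [grad w] or [w - wb]. *)
Lemma Bh_test_one (u : vbroken M) c cb :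
  Bh P u c cb (fun _ _ => 1) (fun=> 1) = 0.
Proof.
rewrite /Bh /Ba /Bd !big1 ?addr0// => K _.
- rewrite cell_int0; last by move=> x; rewrite grad_cst dot0r.
  rewrite bdry_int0; last by move=> F n x; rewrite subrr mulr0.
  rewrite bdry_int0; last by move=> F n x; rewrite subrr scale0r dot0r.
  rewrite bdry_int0; last by move=> F n x; rewrite grad_cst mulv0r dot0l mul0r.
  by rewrite mulr0 !subr0 addr0.
- rewrite cell_int0; last by move=> x; rewrite grad_cst dot0r mulr0.
  rewrite bdry_int0; last by move=> F n x; rewrite subrr mulr0.
  rewrite bdry_int0; last by move=> F n x; case: ifP => // _; rewrite subrr mulr0.
  by rewrite !oppr0 !addr0.
Qed.

(** Integrals of a curve in [C_h] become fixed linear combinations of its coefficients, so that no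
    differentiation under the integral sign occurs. *)
Lemma cell_int_polyval l (K : {set V}) (b : R) (a : @exponent d.+1 l -> R) :
  cell_int K (fun x => b * polyval a x) =
  \sum_(e : @exponent d.+1 l | (\sum_i e i <= l)%N)
    b * a e * cell_int K (fun x : point => \prod_i x 0 i ^+ e i).
Proof.
have mp (e : @exponent d.+1 l) : polyfun (fun x : point => \prod_i x 0 i ^+ e i).
  by apply: polyfun_prod => i _; apply: polyfunX; exact: polyfun_coord.
rewrite (_ : (fun x => b * polyval a x) =
  (fun x : point => \sum_(e : @exponent d.+1 l | (\sum_i e i <= l)%N)
    b * a e * \prod_i x 0 i ^+ e i)); last first.
  by apply/funext => x; rewrite mulr_sumr; apply: eq_bigr => e _; rewrite mulrA.
rewrite /cell_int simplex_int_sum; last first.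
  move=> e _; apply: polyfun_integrable; apply: polyfunM => //; exact: polyfun_cst.
by apply: eq_bigr => e _; rewrite simplex_intZ//; exact: polyfun_integrable.
Qed.

Lemma transport_conservative l (u : vbroken M) : globally_conservative P l u.
Proof.
move=> f c0 c cb [f2 fcont] c0L2 [[a [cE acont ader]] cbl init ode] t /andP[t0 tT].
pose T := par_T P.
pose m (K : {set V}) (e : @exponent d.+1 l) :=
  cell_int K (fun x : point => \prod_i x 0 i ^+ e i).
pose G s := \sum_(K in cells) \sum_(e : @exponent d.+1 l | (\sum_i e i <= l)%N)
  porosity P K * a s K e * m K e.
pose F s := \sum_(K in cells) cell_int K (fun x => f s x * 1).
have massE s : 0 <= s <= T -> \sum_(K in cells) cell_int K (fun x => porosity P K * c s K x) = G s.
  move=> sT; apply: eq_bigr => K KM; rewrite -cell_int_polyval.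
  by congr (cell_int _ _); apply/funext => x; rewrite cE.
have one_Ch : in_Ch l (fun (_ : {set V}) (_ : point) => 1 : R).
  by move=> K _; exact: is_poly_cst.
have one_Cbar : in_Cbar M l (fun=> 1).
  split; last by apply: continuous_subspaceT => x; exact: cst_continuous.
  by move=> E _; exists (fun=> 1) => //; exact: is_poly_cst.
have T0 : 0 < T by exact: par_T_gt0.
(* The porosity is constant on each element and hence itself an admissible test function for the
   initial projection. *)
have G0 : G 0 = \sum_(K in cells) cell_int K (fun x => porosity P K * c0 x).
  rewrite -massE ?lexx ?ltW//.
  have := init (fun K _ => porosity P K) (fun K _ => is_poly_cst _ _).
  move=> E; etransitivity; [etransitivity; [|exact: E]|].
    by apply: eq_bigr => K _; congr (cell_int _ _); apply/funext => x; rewrite mulrC.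
  by apply: eq_bigr => K _; congr (cell_int _ _); apply/funext => x; rewrite mulrC.
have da K e s : 0 < s < T ->
    is_derive s 1 (fun r => a r K e) ('D_1 (fun r => a r K e) s).
  by move=> sT; apply/derivableP; exact: ader.
have dG s : 0 < s < T -> is_derive s 1 G (F s).
  move=> sT; have dm : is_derive s 1 G (\sum_(K in cells)
      \sum_(e : @exponent d.+1 l | (\sum_i e i <= l)%N)
        porosity P K * 'D_1 (fun r => a r K e) s * m K e).
    apply: is_derive_big_sum => K _; apply: is_derive_big_sum => e _.
    under eq_fun do rewrite mulrAC; rewrite mulrAC.
    by apply: is_derive_scale; exact: da.
  apply: (is_derive_eq dm).
  have := ode s sT _ _ one_Ch one_Cbar; rewrite Bh_test_one addr0 -/(F s) => <-.
  apply: eq_bigr => K KM; rewrite -cell_int_polyval.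
  congr (cell_int _ _); apply/funext => x; rewrite mulr1; congr (_ * _).
  (* The coefficients describe [c] only for times in [[0, T]], which is enough near an interior time
     [s]. *)
  have -> : 'D_1 (fun r => c r K x) s = 'D_1 (fun r => polyval (a r K) x) s.
    apply: near_eq_derive; near=> r; apply: cE => //.
    have : r \in `]0, T[ by near: r; apply: near_in_itvoo; rewrite in_itv.
    by rewrite in_itv/= => /andP[r0 rT]; rewrite !ltW.
  have dp : is_derive s 1 (fun r => polyval (a r K) x)
      (polyval (fun e => 'D_1 (fun r => a r K e) s) x).
    apply: is_derive_big_sum => e _.
    under eq_fun do rewrite mulrC; rewrite mulrC.
    by apply: is_derive_scale; exact: da.
  by rewrite derive_val.
have contG : {within `[0, T], continuous G}.
  apply: within_continuous_big_sum => K; apply: within_continuous_big_sum => e.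
  have -> : (fun s => porosity P K * a s K e * m K e) =
      (fun s => porosity P K * m K e * a s K e).
    by apply/funext => s; rewrite mulrAC.
  by apply: within_continuousZ; exact: acont.
have contF : {within `[0, T], continuous F} by exact: fcont one_Ch.
have -> : \int[lebesgue_measure]_(s in `[0, t]) (\sum_(K in cells) cell_int K (f s)) =
    \int[lebesgue_measure]_(s in `[0, t]) F s.
  apply: eq_Rintegral => s _; apply: eq_bigr => K _.
  by congr (cell_int _ _); apply/funext => x; rewrite mulr1.
rewrite massE ?t0// -G0.
move: t0; rewrite le_eqVlt => /predU1P[<-|t0].
  by rewrite set_itv1 Rintegral_set1 addr0.
have sub : `[0, t] `<=` `[0, T].
  by move=> s; rewrite /= !in_itv/= => /andP[-> st]/=; exact: le_trans st tT.
rewrite /Rintegral (@continuous_FTC2 _ F G)//.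
- by rewrite -EFinB/= addrC subrK.
- exact: continuous_subspaceW sub contF.
- have /(continuous_within_itvP _ t0)[_ c1 c2] := continuous_subspaceW sub contG.
  split=> // s; rewrite in_itv/= => /andP[s0 st].
  by have [] : is_derive s 1 G (F s) by apply: dG; rewrite s0 (lt_le_trans st).
- move=> s; rewrite in_itv/= => /andP[s0 st]; rewrite derive1E.
  have D : is_derive s 1 G (F s) by apply: dG; rewrite s0 (lt_le_trans st).
  by rewrite derive_val.
Unshelve. all: by end_near. Qed.

End Conservation.

(** * Sharpness of the degree condition *)

Section IteratedDerivative.
Context {R : realType} {d : nat}.
Notation point := 'rV[R]_d.+1.
Implicit Types (f q : point -> R) (e : point).

Definition dirD e f : point -> R := fun x => 'D_e f x.

Lemma iter_dirD_low e m q : is_poly m q -> iter m.+1 (dirD e) q = fun=> 0.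
Proof.
elim: m q => [|m IH] q qm; first exact: derive_is_poly0.
by rewrite iterSr IH//; exact: (is_poly_derive e qm).
Qed.

Lemma iter_dirD_power (i : 'I_d.+1) n (c : R) :
  iter n (dirD (delta_mx 0 i)) (fun x => c * x 0 i ^+ n) = fun=> c * n`!%:R.
Proof.
elim: n c => [|n IH] c; first by apply/funext => x /=; rewrite expr0 fact0.
rewrite iterSr.
have -> : dirD (delta_mx 0 i) (fun x : point => c * x 0 i ^+ n.+1) =
    (fun x => c * n.+1%:R * x 0 i ^+ n).
  apply/funext => x; rewrite /dirD.
  have D := is_deriveX n.+1 (is_derive_coord x (delta_mx 0 i : point) i).
  have D' := is_derive_scale c D.
  rewrite (_ : (fun y : point => c * y 0 i ^+ n.+1) =
    (fun y => c * ((fun z : point => z 0 i) ^+ n.+1) y)); last first.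
    by apply/funext => y; rewrite fctE.
  by rewrite derive_val /= mxE !eqxx /GRing.scale/= mulr1 mulrA.
by rewrite IH; apply/funext => x; rewrite factS natrM mulrA.
Qed.

Section Bubble.
Context {V : finType} {pos : V -> point} {K : {set V}}
  {lam : V -> point -> R} {g : V -> point}.
Hypotheses (Kd : #|K| = d.+2) (bK : barycentric pos K lam g).

Definition bubble : point -> R := fun x => \prod_(v in K) lam v x.

Lemma polyfun_bubble : polyfun bubble.
Proof. by apply: polyfun_prod => v _; exact: (polyfun_lam bK). Qed.

Lemma bubble_eq0 v x : v \in K -> lam v x = 0 -> bubble x = 0.
Proof. by move=> vK lx; rewrite /bubble (bigD1 v)//= lx mul0r. Qed.

(** The exponent [n] counts the order of vanishing on the boundary of [K]. Each derivative lowers it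
    by at most one, which replaces any bookkeeping of traces. *)
Definition bubble_multiple n f :=
  exists2 h, polyfun h & f = fun x => bubble x ^+ n * h x.

Lemma bubble_multiple_derive e n f :
  bubble_multiple n.+1 f -> bubble_multiple n (dirD e f).
Proof.
move=> [h hp ->]; have bp := polyfun_bubble.
exists (fun x => bubble x * 'D_e h x + n.+1%:R * 'D_e bubble x * h x).
  apply: polyfunD; first by apply: polyfunM => //; exact: polyfun_derive.
  apply: polyfunM => //; apply: polyfunM; first exact: polyfun_cst.
  exact: polyfun_derive.
apply/funext => x; rewrite /dirD.
have Db : is_derive x e bubble ('D_e bubble x).
  by apply/derivableP; exact: polyfun_derivable.
have Dh : is_derive x e h ('D_e h x).
  by apply/derivableP; exact: polyfun_derivable.
have D := is_deriveM (is_deriveX n.+1 Db) Dh.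
rewrite (_ : (fun y => bubble y ^+ n.+1 * h y) = bubble ^+ n.+1 * h); last first.
  by apply/funext => y; rewrite !fctE.
rewrite derive_val !fctE /GRing.scale/= exprS; ring.
Qed.

Lemma iter_bubble_multiple e n m f :
  bubble_multiple (n + m) f -> bubble_multiple m (iter n (dirD e) f).
Proof.
elim: n m f => [|n IH] m f //= fb; apply: bubble_multiple_derive.
by apply: IH; rewrite addnS.
Qed.

Lemma bubble_multiple_polyfun n f : bubble_multiple n f -> polyfun f.
Proof.
move=> [h hp ->]; apply: polyfunM => //; apply: polyfunX; exact: polyfun_bubble.
Qed.

Lemma bubble_multiple_eq0 n f v x : bubble_multiple n.+1 f -> v \in K ->
  lam v x = 0 -> f x = 0.
Proof.
by move=> [h _ ->] vK lx; rewrite (bubble_eq0 vK lx) expr0n mul0r.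
Qed.

Hypothesis K0 : \det (edges pos d.+1 K) != 0.

(** One bubble factor makes [f] vanish on every facet, so the divergence theorem has no boundary
    terms. *)
Lemma bubble_by_parts e f q : bubble_multiple 1 f -> polyfun q ->
  simplex_int pos d.+1 K (fun x => dirD e f x * q x) =
  - simplex_int pos d.+1 K (fun x => f x * dirD e q x).
Proof.
move=> fb qp; have fp := bubble_multiple_polyfun fb.
have [n nP] : exists n : V -> point,
    forall v, v \in K -> is_outward_normal pos K (K :\ v)%SET (n v).
  exists (fun v => xget 0 [set n | is_outward_normal pos K (K :\ v)%SET n]) => v vK.
  have [n nv] := exists_outward_normal Kd bK vK.
  exact: (@xgetPex _ 0 [set n | is_outward_normal pos K (K :\ v)%SET n] (ex_intro _ n nv)).
have := divergence_simplex Kd bK e K0 (polyfunM fp qp) nP.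
rewrite big1; last first.
  move=> v vK; rewrite (eq_simplex_int (g := fun=> 0) (facet_card Kd vK)).
    by rewrite simplex_int0 mulr0.
  move=> x xF; rewrite (bubble_multiple_eq0 fb vK) ?mul0r//.
  by apply: (lam_hull_notin bK) xF; rewrite ?subD1set// !inE eqxx.
have -> : (fun x => 'D_e (fun y => f y * q y) x) =
    (fun x => dirD e f x * q x + f x * dirD e q x).
  apply/funext => x; rewrite (deriveM (f := f) (g := q)); last 2 first.
  - exact: polyfun_derivable.
  - exact: polyfun_derivable.
  by rewrite /GRing.scale/= addrC mulrC.
rewrite simplex_intD; last 2 first.
- by apply: polyfun_integrable; apply: polyfunM => //; exact: polyfun_derive.
- by apply: polyfun_integrable; apply: polyfunM => //; exact: polyfun_derive.
by move/eqP; rewrite addr_eq0 => /eqP.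
Qed.

(** The outermost derivative is moved first; the function under it still carries one bubble factor
    after the inner derivatives. *)
Lemma bubble_by_parts_iter e n f q : bubble_multiple n f -> polyfun q ->
  simplex_int pos d.+1 K (fun x => iter n (dirD e) f x * q x) =
  (-1) ^+ n * simplex_int pos d.+1 K (fun x => f x * iter n (dirD e) q x).
Proof.
elim: n f q => [|n IH] f q fb qp; first by rewrite expr0 mul1r.
rewrite iterS bubble_by_parts//; last first.
  by apply: iter_bubble_multiple; rewrite addn1.
rewrite IH; last 2 first.
- case: fb => h hp ->; exists (fun x => bubble x * h x).
    by apply: polyfunM => //; exact: polyfun_bubble.
  by apply/funext => x; rewrite exprSr mulrA.
- exact: polyfun_derive.
by rewrite exprS mulN1r mulNr -iterSr.
Qed.

(** Positivity is read off the Dirichlet formula, so no argument about sets of positive measure is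
    required. *)
Lemma bubble_int_gt0 n : 0 < simplex_int pos d.+1 K (fun x => bubble x ^+ n).
Proof.
have := simplex_int_bary_monomial bK (fun=> n) Kd (fintype.subxx K).
rewrite (_ : (fun x => _) = (fun x => bubble x ^+ n)); last first.
  by apply/funext => x; rewrite prodrXl.
move=> ->; rewrite (gram_cell _) mulr_gt0 ?normr_gt0//.
by rewrite divr_gt0// ltr0n ?fact_gt0// prodn_gt0// => v; exact: fact_gt0.
Qed.

End Bubble.
End IteratedDerivative.

Section Sharpness.
Context {R : realType} {d : nat} (M : mesh R d.+1) (P : params R d.+1).
Notation point := 'rV[R]_d.+1.
Notation V := (mvertex M).
Notation pos := (@mpos R d.+1 M).
Notation cells := (cells M).

(** A source orthogonal to [Q_h] is invisible to the flow scheme, which is then solved by the fluid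
    at rest with zero pressures. *)
Lemma zero_velocity_solution k fd :
  (forall q, in_Qh (M := M) k q ->
     \sum_(K in mesh_d M) cell_int K (fun x => fd x * q K x) = 0) ->
  velocity_solution P k (fun=> 0) fd ((fun _ _ => 0) : vbroken M).
Proof.
move=> fdq; exists (fun=> 0), (fun _ _ => 0), (fun _ _ => 0), (fun _ _ => 0).
have Q0 (T : {set {set V}}) : in_Qbar k T (fun _ _ => 0 : R).
  by move=> F _; exists (fun=> 0) => //; exact: is_poly0.
split.
  split=> //.
  - move=> K _ i; under eq_fun do rewrite mxE; exact: is_poly0.
  - split=> //.
      move=> F _ i; exists (fun=> 0); first exact: is_poly0.
      by move=> x _; rewrite mxE.
    by apply: continuous_subspaceT => x; exact: cst_continuous.
  - split; first by move=> K _; exact: is_poly0.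
    by rewrite big1// => K _; exact: cell_int0.
move=> v vb q qs qd _ _ qQ _ _; rewrite fdq// [X in _ = X + _]big1; last first.
  by move=> K _; apply: cell_int0 => x; rewrite dot0l.
rewrite addr0 /ah interface_int0; last first.
  by move=> F n x; rewrite {1}/tangential dot0l scale0r subr0 dot0l mulr0.
rewrite addr0 !big1 ?addr0 ?add0r; last 2 first.
- by move=> K _; apply: cell_int0 => x; rewrite dot0l mulr0.
- move=> K _; rewrite cell_int0; last by move=> x; rewrite strain0 frob0l mulr0.
  rewrite !bdry_int0 ?subr0 ?addr0// => F n x.
  + by rewrite ?subrr ?oppr0 dot0r.
  + by rewrite strain0 mulv0l scaler0 dot0l.
  + by rewrite ?subrr ?oppr0 ?subr0 dot0l mulr0.
rewrite bh_zero_velocity addr0 /bh interface_int0; last by move=> F n x; rewrite subrr mul0r.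
rewrite subr0 !big1 ?addr0 ?oppr0// => K _; try (apply: bdry_int0 => F n x).
- by rewrite mul0r.
- by rewrite mul0r.
- by apply: cell_int0 => x; rewrite mul0r.
Qed.

(* A Rodrigues-type source [D^k (b^(k+1))], with [b] the bubble function of one
   Darcy element: it is orthogonal to the polynomials of degree [k - 1] and not
   to [x_0^k], and the corresponding discrete flow is at rest. *)
Lemma not_compatible_high k l : (0 < k)%N -> (k <= l)%N ->
  exists fd, [/\ flow_data M (fun=> 0) fd, nonzero_source M fd &
    ~ compatible M P k l (fun=> 0) fd].
Proof.
move=> k0 kl; have /card_gt0P[K KTd] := mesh_d_nonempty M.
have Kc := mesh_d_cells KTd; have Kd := mesh_card Kc.
have [lam [g bK]] := cell_barycentric Kc; have K0 := cell_det_neq0 Kc.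
pose e : point := delta_mx 0 0.
pose b : point -> R := bubble (K := K) (lam := lam).
pose f0 := iter k (dirD e) (fun x => b x ^+ k.+1).
have bm : bubble_multiple (K := K) (lam := lam) (k + 1) (fun x => b x ^+ k.+1).
  exists (fun=> 1); first exact: polyfun_cst.
  by apply/funext => x; rewrite addn1 mulr1.
have bmk : bubble_multiple (K := K) (lam := lam) k (fun x => b x ^+ k.+1).
  exists b; first exact: (polyfun_bubble bK).
  by apply/funext => x; rewrite exprSr.
have f0b : bubble_multiple (K := K) (lam := lam) 1 f0.
  exact: (iter_bubble_multiple bK).
have f0p : polyfun f0 by exact: (bubble_multiple_polyfun bK f0b).
(* The extension by 0 is consistent because [f0] retains one bubble factor and vanishes on the
   boundary of [K]. *)
pose fd x := if x \in hull pos K then f0 x else 0.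
have fdK t : @ref_simplex R d.+1 t -> fd (param pos K t) = f0 (param pos K t).
  by move=> /(param_hull pos Kd) Kt; rewrite /fd mem_set.
have fdL L t : L \in cells -> L != K -> @ref_simplex R d.+1 t ->
    fd (param pos L t) = 0.
  move=> Lc LK /(param_hull pos (mesh_card Lc)); set x := param _ _ _ => xL.
  rewrite /fd; case: ifP => // /set_mem xK.
  have : hull pos (L :&: K)%SET x by rewrite -mesh_conforming.
  (* By conformity a point common to [L] and [K] lies in the face spanned by [L :&: K], where the
     coordinate of a vertex [v] outside [L] vanishes. *)
  have [v vK vL] : exists2 v, v \in K & v \notin L.
    apply/subsetPn; apply: contra LK => KL; rewrite eq_sym eqEcard KL.
    by rewrite (mesh_card Lc) Kd leqnn.
  move=> xKL; apply: (bubble_multiple_eq0 f0b vK).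
  by apply: (lam_hull_notin bK) xKL; rewrite ?subsetIr// inE (negbTE vL).
have fd_int (q : broken M) :
    \sum_(L in mesh_d M) cell_int L (fun x => fd x * q L x) =
    simplex_int pos d.+1 K (fun x => f0 x * q K x).
  rewrite (bigD1 K)//= [X in _ + X]big1 ?addr0; last first.
    move=> L /andP[LM LK]; rewrite /cell_int.
    rewrite (eq_simplex_int_param (g := fun=> 0)) ?simplex_int0// => t ts.
    by rewrite fdL ?mul0r//; exact: mesh_d_cells.
  by apply: eq_simplex_int_param => t ts; rewrite fdK.
have f0_low q : is_poly k.-1 q -> simplex_int pos d.+1 K (fun x => f0 x * q x) = 0.
  move=> qk; rewrite (bubble_by_parts_iter Kd bK K0)//; last exact: (is_poly_polyfun qk).
  rewrite -(prednK k0) iter_dirD_low// [X in _ * X](_ : _ = 0) ?mulr0//.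
  by under eq_fun do rewrite mulr0; exact: simplex_int0.
(* After [k] derivatives [w] is the constant [k!], so that its moment against [f0] is, up to sign,
   [k!] times the positive integral of [b ^+ k.+1]. The factor 1 matches [iter_dirD_power]. *)
pose w : point -> R := fun x => 1 * x 0 0 ^+ k.
have wk : is_poly k w.
  apply: is_polyZ; elim: (k) => [|n IH]; first exact: is_poly_cst.
  under eq_fun do rewrite exprS.
  exact: (is_polyM (is_poly_coord 0) IH).
have f0w : simplex_int pos d.+1 K (fun x => f0 x * w x) != 0.
  rewrite (bubble_by_parts_iter Kd bK K0)//; last exact: (is_poly_polyfun wk).
  rewrite mulf_neq0 ?signr_eq0// iter_dirD_power mul1r.
  under eq_fun do rewrite mulrC.
  rewrite simplex_intZ; last first.
    by apply: polyfun_integrable; apply: polyfunX; exact: (polyfun_bubble bK).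
  by rewrite mulf_neq0 ?pnatr_eq0 -?lt0n ?fact_gt0// gt_eqF// (bubble_int_gt0 Kd bK).
have fd2 : L2_on (mesh_d M) fd.
  move=> L LM; apply: simplex_bounded_L2.
  have h : exists2 h, polyfun h & forall t, @ref_simplex R d.+1 t ->
      fd (param pos L t) = h (param pos L t).
    have [->|LK] := eqVneq L K; first by exists f0.
    exists (fun=> 0); first exact: polyfun_cst.
    by move=> t; apply: fdL => //; exact: mesh_d_cells.
  have [h' hp fh] := h; have [mh [B hB]] := polyfun_bounded (pos := pos) (m := d.+1) (S := L) hp.
  split; last by exists B => t ts; rewrite fh// hB.
  by apply: eq_measurable_fun mh => t; rewrite inE => /fh.
have fdQ q : in_Qh (M := M) k q -> \sum_(L in mesh_d M) cell_int L (fun x => fd x * q L x) = 0.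
  by move=> [qk _]; rewrite fd_int f0_low//; exact: qk.
have mean0 : \sum_(L in mesh_d M) cell_int L fd = 0.
  have := fd_int (fun _ _ => 1); rewrite f0_low; last exact: is_poly_cst.
  by move=> E; rewrite -[RHS]E; apply: eq_bigr => L _; under [in RHS]eq_fun do rewrite mulr1.
exists fd; split.
- split=> // i L LM; under eq_fun do rewrite mxE.
  exact: (simplex_bounded_L2 (simplex_bounded_cst _ _ _ 0)).
(* A source of zero L^2 norm would be orthogonal to [w]. *)
- apply/eqP => ff0; move/eqP: f0w; apply.
  rewrite -(fd_int (fun=> w)); apply: big1 => L LM; apply: simplex_int_sqr_eq0.
  + exact: fd2.
  + exact: (polyfun_bounded (is_poly_polyfun wk)).
  + exact: (@sum_sqr_eq0 _ _ _ (mesh_d M) (fun=> fd) L ff0 LM).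
(* For the fluid at rest and [a = 1], the defect at [w] is just the nonzero moment of [f0] against
   [w]. *)
- have sol := zero_velocity_solution fdQ.
  move=> /(_ _ sol)[_ /(_ 1)] /(preserves_constantE P l 1 fd2 (velocity_solutionP sol)).
  move=> /(_ (fun=> w) (fun L _ => is_polyW kl wk)); rewrite mul1r /defect.
  rewrite big1 ?add0r; last by move=> L _; apply: cell_int0 => x; rewrite diverg0 mulr0.
  by rewrite fd_int => /eqP; exact/negP.
Qed.

End Sharpness.

(** * From vanishing defect to compatibility *)

Lemma compatibleP (R : realType) (d : nat) (M : mesh R d.+1) (P : params R d.+1)
    (k l : nat) fs fd : L2_on (mesh_d M) fd ->
  (forall u : vbroken M, velocity_solution P k fs fd u ->
     forall w, in_Ch l w -> defect u fd w = 0) ->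
  compatible M P k l fs fd.
Proof.
move=> f2 H u sol; split; first exact: transport_conservative.
move=> a; apply/(preserves_constantE P l a f2 (velocity_solutionP sol)) => w wl.
by rewrite (H u sol w wl) mulr0.
Qed.


Theorem mainTheorem1 (R : realType) (dim : nat) (M : mesh R dim)
    (P : params R dim) (k l : nat) :
  (dim = 2 \/ dim = 3)%N -> (0 < k)%N ->
  (* a != 0 is needed for the direct implication: a = 0 is always preserved *)
  (forall (fs : 'rV[R]_dim -> 'rV[R]_dim) (fd : 'rV[R]_dim -> R)
      (u : vbroken M) (pf : broken M),
     (forall i, L2_on (mesh_s M) (fun x => fs x 0 i)) ->
     L2_on (mesh_d M) fd ->
     velocity_solution P k fs fd u ->
     is_PiQ k fd pf ->
     (forall a : R, a != 0 ->
        (preserves_constant P l u fd a <-> projection_exact l fd pf)) /\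
     ((forall a : R, preserves_constant P l u fd a) <->
        projection_exact l fd pf))
  /\
  ((forall fs fd, flow_data M fs fd -> nonzero_source M fd ->
      compatible M P k l fs fd) <-> (l <= k.-1)%N)
  /\
  ((k.-1 <= l)%N ->
   ((forall fs fd, flow_data M fs fd -> nonzero_source M fd ->
       compatible M P k l fs fd) <-> l = k.-1))
  /\
  (forall fs fd, flow_data M fs fd -> ~ nonzero_source M fd ->
     compatible M P k l fs fd).
Proof.
move=> dim23 k0.
(* Dimension 0 is excluded, which puts the mesh in the form [mesh R d.+1] of the preceding
   results. *)
case: dim M P dim23 => [M P [] //|d M P _].
have low : (forall fs fd, flow_data M fs fd -> nonzero_source M fd ->
    compatible M P k l fs fd) <-> (l <= k.-1)%N.
  split=> [H|lk fs fd [_ f2 f0] _].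
    rewrite leqNgt; apply/negP => kl; rewrite prednK// in kl.
    have [fd [fdata fd0]] := @not_compatible_high R d M P k l k0 kl.
    by apply; exact: H.
  apply: compatibleP => // u sol w wl.
  exact: (defect_eq0_low (velocity_solutionP sol) f2 f0 lk wl).
split; [|split=> //; split].
- move=> fs fd u pf _ f2 /velocity_solutionP sol pfQ.
  have prE a := preserves_constantE P l a f2 sol.
  have exE := defect_projection_exact l sol f2 pfQ.
  split=> [a a0|].
    rewrite (prE a) -exE; split=> H w wl; last by rewrite H// mulr0.
    by have /eqP := H w wl; rewrite mulf_eq0 (negbTE a0) => /eqP.
  rewrite -exE; split=> [H w wl|H a].
    by have /(prE 1)/(_ w wl) := H 1; rewrite mul1r.
  by apply/(prE a) => w wl; rewrite H// mulr0.
- move=> kl; rewrite low; split=> [lk|->//].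
  by apply/eqP; rewrite eqn_leq lk.
- move=> fs fd [_ f2 f0] /negP; rewrite negbK => /eqP ff0.
  apply: compatibleP => // u sol w wl.
  exact: (defect_eq0_nosource (velocity_solutionP sol) f2 ff0 (in_broken_poly wl)).
Qed.
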